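(* Let $G$ be a connected graph on $n$ vertices with $n\geq 3\kappa(G)+3$. If $\alpha(G)\leq \kappa(G)+1$, then $G$ has a 2-factor with at most two components, unless $G\in\mathcal{G}$.
   Context: All graphs are finite, undirected, and without loops. $\alpha(G)$ denotes the independence number and $\kappa(G)$ the (vertex) connectivity of $G$. A 2-factor of $G$ is a spanning subgraph in which every vertex has degree 2; equivalently, a collection of vertex-disjoint cycles covering all vertices. Its components are these cycles. $K_a$ denotes the complete graph on $a$ vertices. For $n=|V(G)|$, define three graphs on $n$ vertices: - $G_1$: take disjoint cliques $K_{n-2}$ and $K_2$, and join two vertices of $K_{n-2}$ to the same vertex of $K_2$. - $G_2$: take disjoint cliques $K_{n-1}$ and $K_1$, and join one vertex of $K_{n-1}$ to the vertex of $K_1$. - $G_3$: take disjoint cliques $K_{n-2}$ and $K_2$, and add a single edge joining one vertex of $K_{n-2}$ to one vertex of $K_2$. Define $\mathcal{G}=\{G : G_1\subseteq G\subseteq G_2\}\cup\{G_3\}$, where $G_1\subseteq G\subseteq G_2$ means that, up to isomorphism, $G$ contains $G_1$ as a spanning subgraph and is itself a spanning subgraph of $G_2$. Concretely, the graphs in the first part of $\mathcal{G}$ have the following form: an $(n-2)$-clique $Q$; a vertex $w$ adjacent to at least two vertices of $Q$; and a vertex $z$ whose only neighbor is $w$. *)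

(* Defs.v *)
From mathcomp Require Import all_boot.

Set Implicit Arguments.
Unset Strict Implicit.
Unset Printing Implicit Defensive.

Record sgraph (V : finType) := SGraph {
  adj :> rel V;
  adj_sym : symmetric adj;
  adj_irrefl : irreflexive adj }.

Section Invariants.

Variables (V : finType) (G : sgraph V).

Definition induced (A : {set V}) : rel V :=
  [rel x y | [&& x \in A, y \in A & G x y]].

Definition connected_on (A : {set V}) : bool :=
  (A != set0) && [forall x in A, forall y in A, connect (induced A) x y].

Definition connected_graph : bool := connected_on [set: V].

Definition k_connected (k : nat) : bool :=
  (k < #|V|) && [forall X : {set V}, (#|X| < k) ==> connected_on (~: X)].

(* The greatest k such that G is k-connected; in particular a complete graph
   on n > 0 vertices has connectivity n - 1. *)
Definition kappa : nat := \max_(k < #|V| | k_connected k) k.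

Definition independent (S : {set V}) : bool :=
  [forall x in S, forall y in S, ~~ G x y].

Definition alpha : nat := \max_(S : {set V} | independent S) #|S|.

Definition degree (x : V) : nat := #|[set y | G x y]|.

Definition n_components : nat := n_comp G V.

End Invariants.

Definition two_factor (V : finType) (G F : sgraph V) : Prop :=
  (forall x y, F x y -> G x y) /\ (forall x, degree F x = 2).

Definition spanning_embeds (V W : finType) (H : sgraph V) (G : sgraph W) : Prop :=
  exists2 f : V -> W, bijective f & forall x y, H x y -> G (f x) (f y).

Definition isomorphic (V W : finType) (H : sgraph V) (G : sgraph W) : Prop :=
  exists2 f : V -> W, bijective f & forall x y, G (f x) (f y) = H x y.

Section JoinedCliques.

Variables (a b : nat) (J : 'I_a -> 'I_b -> bool).

Definition joined_cliques_rel : rel ('I_a + 'I_b)%type := fun u v =>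
  match u, v with
  | inl i, inl j => i != j
  | inr i, inr j => i != j
  | inl i, inr j => J i j
  | inr j, inl i => J i j
  end.

Lemma joined_cliques_sym : symmetric joined_cliques_rel.
Proof. by move=> [i|i] [j|j] //=; rewrite eq_sym. Qed.

Lemma joined_cliques_irrefl : irreflexive joined_cliques_rel.
Proof. by move=> [i|i] /=; rewrite eqxx. Qed.

(* Disjoint cliques K_a and K_b together with the cross edges given by J. *)
Definition joined_cliques : sgraph ('I_a + 'I_b)%type :=
  SGraph joined_cliques_sym joined_cliques_irrefl.

End JoinedCliques.

Definition G1 (n : nat) : sgraph ('I_(n - 2) + 'I_2)%type :=
  joined_cliques (fun i j => (i < 2) && (j == 0 :> nat)).

Definition G2 (n : nat) : sgraph ('I_(n - 1) + 'I_1)%type :=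
  joined_cliques (fun i j => i == 0 :> nat).

Definition G3 (n : nat) : sgraph ('I_(n - 2) + 'I_2)%type :=
  joined_cliques (fun i j => (i == 0 :> nat) && (j == 0 :> nat)).

Definition exceptional (V : finType) (G : sgraph V) : Prop :=
  (spanning_embeds (G1 #|V|) G /\ spanning_embeds G (G2 #|V|))
  \/ isomorphic (G3 #|V|) G.

(* Main.v *)
(* Chvatal-Erdos style rotation arguments.  Let k be the connectivity.

   If k = 1, a cut vertex leaves two cliques and is complete to one of them,
   and the conclusion is read off.

   If k >= 2, choose a cycle c minimising the independence number of G - c, and
   then the size of a component F of G - c.  Let X be the set of neighbours of F
   on c, and O the rest of G - c.  For y in X take the shortest piece of c
   following y whose addition to O increases the independence number of O.
   Pieces of different y cannot be linked through O, otherwise c could be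
   rerouted through F to a better choice; hence adding all of them increases
   alpha by |X| >= k (Kouider's argument).  As alpha(G) <= k + 1, the graph
   G - c is a clique hs with exactly k neighbours on c.  If |hs| >= 3, c and hs
   give the two cycles.

   If |hs| <= 2, a path through hs joins any two vertices of X, and exchanging
   edges of c for such a path and one or two chords produces two covering cycles
   unless the chords are absent.  These non-edges, against the bound k + 1 on
   independent sets, show that the segments of c between consecutive vertices of
   X have at most two vertices, with at most one exception, of three vertices.
   Since n >= 3k + 3, this leaves |hs| = 2 and one exception, where a last
   exchange or a last independent set of k + 2 vertices concludes. *)

Require Import Defs.
From mathcomp Require Import all_boot zify.
From Stdlib Require Import Classical_Prop.

Set Implicit Arguments.
Unset Strict Implicit.
Unset Printing Implicit Defensive.

(** * Cyclic sequences, walks and 2-factors *)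

Section Cyclic.

Variable T : eqType.
Implicit Types (s : seq T) (x y : T).

Lemma next_neq_prev s x : uniq s -> 2 < size s -> x \in s -> next s x != prev s x.
Proof.
move=> Us sz xs; case: (rot_to xs) => i s' E.
have Us' : uniq (rot i s) by rewrite rot_uniq.
apply/eqP=> H; have := next_prev Us x; rewrite -H.
rewrite -!(next_rot i Us) E.
move: sz Us'; rewrite -(size_rot i) E.
case: s' {E H} => [|a [|b t]] //= _.
rewrite !inE !negb_or -!andbA => /and5P[xa xb _ ab _].
rewrite !eqxx eq_sym (negbTE xa) => bx.
by rewrite bx eqxx in xb.
Qed.

Lemma next_cat_head s1 s2 x y : uniq (rcons s1 x ++ y :: s2) ->
  next (rcons s1 x ++ y :: s2) x = y.
Proof.
rewrite cat_rcons => U.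
have U' : uniq (rot (size s1) (s1 ++ [:: x, y & s2])) by rewrite rot_uniq.
by rewrite -(next_rot (size s1) U) rot_size_cat /= eqxx.
Qed.

Lemma next_rcons_cons s x y : uniq (rcons (y :: s) x) -> next (rcons (y :: s) x) x = y.
Proof.
move=> U; rewrite -(next_rot (size (y :: s)) U) -cats1 rot_size_cat /=.
by rewrite eqxx.
Qed.

Lemma next_in_seg (c : seq T) y u J z r v : uniq c -> c = y :: (u :: J) ++ z :: r -> v \in J ->
  exists2 p, p \in u :: J & next c p = v.
Proof.
move=> U E vJ; case/splitPr: vJ E => l1 l2 E.
have [l [p El]] : exists l p, u :: l1 = rcons l p.
  by case/lastP: (l1) => [|l p]; [exists [::], u|exists (u :: l), p].
exists p.
  have : p \in u :: l1 by rewrite El mem_rcons inE eqxx.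
  by rewrite !inE mem_cat => /orP[->//|->]; rewrite orbT.
have E' : c = rcons (y :: l) p ++ v :: (l2 ++ z :: r).
  by rewrite E rcons_cons -El /= -catA.
by rewrite E' next_cat_head // -E'.
Qed.

Lemma mem_split x s : x \in s -> exists s1 s2, s = s1 ++ x :: s2.
Proof. by case/splitPr=> s1 s2; exists s1, s2. Qed.

Definition after s y := behead (rot (index y s) s).

Lemma rot_after s y : y \in s -> rot (index y s) s = y :: after s y.
Proof. by move=> ys; rewrite /after rot_index. Qed.

Lemma after_cat s1 y s2 : uniq (s1 ++ y :: s2) -> after (s1 ++ y :: s2) y = s2 ++ s1.
Proof.
rewrite cat_uniq => /and3P[_ /hasPn/(_ y) + _]; rewrite inE eqxx => /(_ isT) /= ys.
by rewrite /after index_cat (negbTE ys) /= eqxx addn0 rot_size_cat.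
Qed.

Lemma after_split s y z : uniq s -> y \in s -> z \in s -> y != z ->
  exists L1 L2, after s y = L1 ++ z :: L2 /\ after s z = L2 ++ y :: L1.
Proof.
move=> U ys zs yz; have [s1 [s2 E]] := mem_split ys; subst s.
move: zs; rewrite (after_cat U) mem_cat inE eq_sym (negbTE yz) /=.
case/orP=> /mem_split[d1 [d2 E]]; subst.
  exists (s2 ++ d1), d2; rewrite -!catA; split=> //.
  by rewrite -catA cat_cons in U *; rewrite after_cat // -catA.
exists d1, (d2 ++ s1); rewrite -catA; split=> //.
have E : s1 ++ y :: d1 ++ z :: d2 = (s1 ++ y :: d1) ++ z :: d2 by rewrite -catA.
by rewrite E after_cat -?E // -catA.
Qed.

End Cyclic.

(** * Covering cycles as 2-factors *)

Section TwoFactor.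

Variables (V : finType) (G : sgraph V).
Implicit Types (s t : seq V) (x y : V).

Definition cyc s := [&& 2 < size s, cycle G s & uniq s].

Definition cyc_rel s x y := (x \in s) && ((next s x == y) || (prev s x == y)).

Lemma cyc_rel_sym s : uniq s -> symmetric (cyc_rel s).
Proof.
have imp x y : uniq s -> cyc_rel s x y -> cyc_rel s y x.
  move=> U /andP[xs /orP[] /eqP <-]; rewrite /cyc_rel /= ?mem_next ?mem_prev xs /=.
    by rewrite (prev_next U) eqxx orbT.
  by rewrite (next_prev U) eqxx.
by move=> U x y; apply/idP/idP; exact: imp.
Qed.

Lemma cyc_rel_sub s x y : cycle G s -> cyc_rel s x y -> G x y.
Proof.
move=> C /andP[xs /orP[] /eqP <-]; first exact: next_cycle.
by rewrite adj_sym prev_cycle.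
Qed.

Lemma cyc_rel_connect s x y (e : rel V) : uniq s -> subrel (cyc_rel s) e ->
  x \in s -> y \in s -> connect e x y.
Proof.
move=> U sub xs ys.
have: fconnect (next s) x y by rewrite (fconnect_cycle (cycle_next U) xs).
apply: connect_sub => a b /= /eqP <-.
have [as_|as_] := boolP (a \in s).
  by apply/connect1/sub; rewrite /cyc_rel /= as_ eqxx.
by rewrite next_nth (negbTE as_) connect0.
Qed.

(** An empty [t] stands for a Hamiltonian cycle. Every vertex is connected to the head of [s] or to
    that of [t], which bounds the number of components. *)
Lemma two_cycles_two_factor s t : cyc s -> nilp t || cyc t -> perm_eq (s ++ t) (enum V) ->
  exists2 F : sgraph V, two_factor G F & n_components F <= 2.
Proof.
move=> /and3P[sz_s Cs Us] Ct P.
have U : uniq (s ++ t) by rewrite (perm_uniq P) enum_uniq.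
have Ut : uniq t by move: U; rewrite cat_uniq => /and3P[].
have Cyt : cycle G t by case/orP: Ct => [/nilP->|/and3P[]].
have cov x : (x \in s) || (x \in t) by rewrite -mem_cat (perm_mem P) mem_enum.
have dis x : x \in s -> x \in t -> False.
  by move=> xs xt; move: U; rewrite cat_uniq => /and3P[_ /hasPn/(_ _ xt)]; rewrite /= xs.
pose e := [rel x y | cyc_rel s x y || cyc_rel t x y].
have esym : symmetric e by move=> x y; rewrite /e /= (cyc_rel_sym Us x y) (cyc_rel_sym Ut x y).
have esub x y : e x y -> G x y by case/orP; exact: cyc_rel_sub.
have eirr : irreflexive e by move=> x; apply/negbTE/negP=> /esub; rewrite adj_irrefl.
exists (SGraph esym eirr); first split=> //.
  move=> x; rewrite /degree.
  have key r : uniq r -> 2 < size r -> x \in r -> #|[set y | cyc_rel r x y]| = 2.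
    move=> Ur sz xr; have -> : [set y | cyc_rel r x y] = [set next r x; prev r x].
      by apply/setP=> y; rewrite !inE /cyc_rel xr /= ![_ == y]eq_sym.
    by rewrite cards2 next_neq_prev.
  case/orP: (cov x) => xr.
    rewrite -(key s) //; apply: eq_card=> y; rewrite !inE /= /cyc_rel.
    by rewrite (negbTE (introN idP (dis x xr))) orbF.
  rewrite -(key t) //; last by case/orP: Ct xr => [/nilP->|/and3P[]].
  apply: eq_card=> y; rewrite !inE /= /cyc_rel.
  have /negbTE-> : x \notin s by apply/negP=> xs; exact: dis xs xr.
  by [].
have csym : connect_sym e by exact: sym_connect_sym.
case: s sz_s Us {Cs P U} cov dis @e esym esub eirr csym => [//|x0 s] _ Us cov dis e esym esub eirr csym.
(* For empty [t] the default [x0] merely repeats the root of [s]. *)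
pose y0 := head x0 t.
rewrite /n_components /n_comp_mem /=.
apply: (@leq_trans #|[set root e x0; root e y0]|); last by rewrite cards2; case: eqP.
apply/subset_leq_card/subsetP=> x; rewrite !inE => /andP[/eqP rx _].
case/orP: (cov x) => xr.
  apply/orP; left; rewrite -rx (root_connect csym) csym.
  apply: (@cyc_rel_connect (x0 :: s)) => //; last by rewrite inE eqxx.
  by move=> a b H; apply/orP; left.
apply/orP; right; rewrite -rx (root_connect csym) csym.
apply: (@cyc_rel_connect t) => //; last by rewrite /y0; case: (t) xr => //= a l _; rewrite inE eqxx.
by move=> a b H; apply/orP; right.
Qed.

End TwoFactor.

(** * Walks with prescribed ends *)

Section Walks.

Variables (V : finType) (G : sgraph V).
Implicit Types (s t : seq V) (a b x y : V).

(** Carrying both ends as arguments lets a rerouted cycle be assembled and checked piece by piece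
    with [walk_cat]. The empty list is not a walk. *)
Definition walk s a b :=
  if s is x :: s' then [&& x == a, last x s' == b & path G x s'] else false.

Lemma walk1 x : walk [:: x] x x.
Proof. by rewrite /= !eqxx. Qed.

Lemma walk_cat s t a b c d : walk s a b -> walk t c d -> G b c -> walk (s ++ t) a d.
Proof.
case: s t => [|x s] [|y t] //= /and3P[/eqP-> /eqP lb p] /and3P[/eqP-> /eqP ld q] e.
by rewrite eqxx last_cat /= ld eqxx cat_path p lb /= e.
Qed.

Lemma walk_catE s t a d : walk (s ++ t) a d -> s != [::] -> t != [::] ->
  exists b c, [/\ walk s a b, walk t c d & G b c].
Proof.
case: s t => [|x s] [|y t] //= /and3P[/eqP<-]; rewrite last_cat cat_path /=.
move=> ld /and3P[p e q] _ _; exists (last x s), y.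
by split; rewrite //= ?eqxx ?ld ?p ?q.
Qed.

Lemma walk_cons x s a b : walk s a b -> G x a -> walk (x :: s) x b.
Proof. by move=> w e; rewrite -cat1s; apply: walk_cat w e; exact: walk1. Qed.

Lemma walk_rev s a b : walk s a b -> walk (rev s) b a.
Proof.
elim: s a b => [//|x s IH] a b; case: s IH => [|y s] IH.
  by case/and3P=> /eqP<- /eqP<- _; exact: walk1.
case/and3P=> /eqP<- /eqP <- /= /andP[e p]; rewrite rev_cons -cats1.
apply: (@walk_cat _ _ _ y) (walk1 _) _; last by rewrite adj_sym.
by apply: IH; rewrite /= !eqxx p.
Qed.

Lemma walk_cycle s a b : walk s a b -> G b a -> cycle G s.
Proof.
by case: s => [//|x s] /and3P[/eqP<- /eqP<- p] e; rewrite /= rcons_path p.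
Qed.

Lemma cycle_walk s : cycle G s -> s != [::] -> exists a b, walk s a b /\ G b a.
Proof.
case: s => [//|x s] /=; rewrite rcons_path => /andP[p e] _.
by exists x, (last x s); rewrite !eqxx p.
Qed.

Lemma walk_head s a b : walk s a b -> a \in s.
Proof. by case: s => //= x s /and3P[/eqP-> _ _]; rewrite inE eqxx. Qed.

Lemma walk_headE x s a b : walk (x :: s) a b -> a = x.
Proof. by case/and3P=> /eqP. Qed.

Lemma walk1E x a b : walk [:: x] a b -> a = x /\ b = x.
Proof. by case/and3P=> /eqP-> /eqP/= <-. Qed.

Lemma walk_next s t a b c d : walk s a b -> walk t c d -> uniq (s ++ t) ->
  next (s ++ t) b = c.
Proof.
case/lastP: s => [//|s x]; case: t => [//|y t] ws /walk_headE->.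
have := walk_rev ws; rewrite rev_rcons => /walk_headE->.
exact: next_cat_head.
Qed.

Lemma walk_next_wrap s t a b c d : walk s a b -> walk t c d -> uniq (s ++ t) ->
  next (s ++ t) d = a.
Proof.
move=> ws wt U; rewrite -(next_rot (size s) U) rot_size_cat.
by apply: walk_next wt ws _; rewrite uniq_catC.
Qed.

Lemma path_walk u p v s b : path G u (rcons p v) -> walk (v :: s) v b ->
  exists a, walk (p ++ v :: s) a b /\ G u a.
Proof.
case: p => [|x p] /=; first by rewrite andbT => e w; exists v.
rewrite rcons_path => /and3P[e pp e'] w; exists x; split=> //.
by apply: (@walk_cat (x :: p) (v :: s) x (last x p) v b) => //=; rewrite !eqxx pp.
Qed.

Lemma walk_neq s a b : walk s a b -> uniq s -> 1 < size s -> a != b.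
Proof.
case: s => [|x [|y s]] //= /and3P[/eqP-> /eqP <- _] /andP[xs _] _.
by apply: contraNneq xs => ->; exact: mem_last.
Qed.

Lemma clique_path x s : uniq (x :: s) -> {in x :: s &, forall y z, y != z -> G y z} -> path G x s.
Proof.
elim: s x => //= y s IH x /andP[]; rewrite inE negb_or => /andP[xy xs] U K.
rewrite K ?inE ?eqxx ?orbT //= IH //.
by move=> u v us vs; apply: K; rewrite inE ?us ?vs orbT.
Qed.

Lemma clique_cyc s : uniq s -> 2 < size s -> {in s &, forall y z, y != z -> G y z} -> cyc G s.
Proof.
move=> U sz K; rewrite /cyc sz U andbT /=.
case: s U sz K => // x s U sz K.
apply: (@walk_cycle _ x (last x s)); first by rewrite /= !eqxx clique_path.
apply: K; rewrite ?mem_last ?inE ?eqxx //.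
case: s U sz => // y s /=/andP[xs _] _; by apply: contraNneq xs => <-; rewrite mem_last.
Qed.

End Walks.

(** * Exchanging edges of a cycle that misses a small clique *)

Section Independent.

Variables (V : finType) (G : sgraph V).

Lemma independentP (S : {set V}) :
  reflect {in S &, forall x y, ~~ G x y} (independent G S).
Proof.
apply: (iffP forall_inP) => H x; first by move=> y xS; move/forall_inP: (H x xS); apply.
by move=> xS; apply/forall_inP=> y; exact: H.
Qed.

Lemma independentU1 x (S : {set V}) :
  independent G S -> {in S, forall y, ~~ G x y} -> independent G (x |: S).
Proof.
move=> /independentP I H; apply/independentP=> y z; rewrite !inE.
case/predU1P=> [->|yS]; case/predU1P=> [->|zS]; first by rewrite adj_irrefl.
- exact: H.
- by rewrite adj_sym H.
- exact: I.
Qed.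

End Independent.

Ltac nat_lia :=
  repeat match goal with H : ?T |- _ =>
    lazymatch type of T with Prop =>
      lazymatch T with is_true (leq _ _) => fail | @eq nat _ _ => fail | _ => clear H end
    end
  end; lia.

(** Comparing the counts of every predicate turns the check that rerouted cycles cover all vertices
    into linear arithmetic. *)
Ltac perm_by_count P :=
  let p := fresh in
  apply/permP; intro p; have := elimT permP P p;
  rewrite -?cats1 /= ?(count_cat, count_rev) /= ?(count_cat, count_rev) /= ?(count_cat, count_rev) /=;
  clear; lia.

Lemma rcons_nnil (T : eqType) (s : seq T) x : rcons s x != [::].
Proof. by case: s. Qed.

Lemma neq_sym (T : eqType) (x y : T) : x != y -> y != x.
Proof. by rewrite eq_sym. Qed.

Lemma has_first (T : Type) (p : pred T) s : has p s ->
  exists s1 x s2, [/\ s = s1 ++ x :: s2, p x & ~~ has p s1].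
Proof. by case/split_find=> x s1 s2 px n; exists s1, x, s2; rewrite cat_rcons. Qed.

Section Rewiring.

Variables (V : finType) (G : sgraph V) (X : {set V}) (hs : seq V) (h0 : V).

(** By [Xlink], all of [hs] can be inserted between any two vertices of [X]. The assumption [noTF],
    made for contradiction, excludes Hamiltonian cycles and pairs of cycles covering the graph. *)
Hypothesis Xlink : forall y z, y \in X -> z \in X -> y != z ->
  exists hs' a b, [/\ perm_eq hs' hs, walk G hs' a b, G y a & G b z].
Hypothesis hsX : forall h v, h \in hs -> v \notin hs -> G h v -> v \in X.
Hypothesis h0hs : h0 \in hs.
Hypothesis noTF : forall s t, cyc G s -> nilp t || cyc G t ->
  perm_eq (s ++ t) (enum V) -> False.
Hypothesis alphaX : forall S, independent G S -> #|S| <= #|X|.+1.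
Hypothesis V3 : 2 < #|V|.
Hypothesis X2 : 1 < #|X|.

(** A cyclic ordering, along edges, of all vertices outside [hs]. It is stable under rotation and
    reversal, so facts on successors transfer to predecessors. *)
Definition spanning_mod_hs c :=
  [/\ cycle G c, perm_eq (c ++ hs) (enum V) & {subset X <= c}].
Notation good := spanning_mod_hs.

Lemma good_uniq_cat c : good c -> uniq (c ++ hs).
Proof. by case=> _ /perm_uniq-> _; exact: enum_uniq. Qed.

Lemma good_uniq c : good c -> uniq c.
Proof. by move/good_uniq_cat; rewrite cat_uniq => /andP[]. Qed.

Lemma good_notin_hs c v : good c -> v \in c -> v \notin hs.
Proof.
move/good_uniq_cat; rewrite cat_uniq => /and3P[_ /hasPn H _] vc.
by apply/negP=> /H; rewrite /= vc.
Qed.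

Lemma good_mem c v : good c -> (v \in c) = (v \notin hs).
Proof.
move=> gc; apply/idP/idP; first exact: good_notin_hs.
case: gc => _ /perm_mem/(_ v); rewrite mem_cat mem_enum => + _.
by case: (v \in c) => //= ->.
Qed.

Lemma good_size_cat c : good c -> size c + size hs = #|V|.
Proof. by case=> _ /perm_size + _; rewrite size_cat cardE. Qed.

Lemma good_rot n c : good c -> good (rot n c).
Proof.
case=> C P S; split; first by rewrite rot_cycle.
  by apply: perm_trans P; rewrite perm_cat2r perm_rot.
by move=> x /S; rewrite mem_rot.
Qed.

Lemma good_rev c : good c -> good (rev c).
Proof.
case=> C P S; split.
- rewrite rev_cycle; rewrite (eq_cycle (e' := G)) // => x y /=.
  by rewrite adj_sym.
- by apply: perm_trans P; rewrite perm_cat2r perm_rev.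
- by move=> x /S; rewrite mem_rev.
Qed.

Lemma ham_false c s a b : good c -> walk G s a b -> G b a -> perm_eq s (c ++ hs) -> False.
Proof.
case=> _ P _ ws e Ps.
have Ps' : perm_eq s (enum V) by apply: perm_trans Ps P.
apply: (@noTF s [::]) => //; last by rewrite cats0.
rewrite /cyc (walk_cycle ws e) (perm_uniq Ps') enum_uniq (perm_size Ps') -cardE.
by rewrite V3.
Qed.

Lemma two_false c s t a b a' b' : good c -> walk G s a b -> G b a -> 2 < size s ->
  walk G t a' b' -> G b' a' -> 2 < size t -> perm_eq (s ++ t) (c ++ hs) -> False.
Proof.
case=> _ P _ ws e sz wt e' sz' Ps.
have Ps' : perm_eq (s ++ t) (enum V) by apply: perm_trans Ps P.
have : uniq (s ++ t) by rewrite (perm_uniq Ps') enum_uniq.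
rewrite cat_uniq => /and3P[Us _ Ut].
apply: (@noTF s t) => //; first by rewrite /cyc (walk_cycle ws e) sz Us.
by rewrite /cyc (walk_cycle wt e') sz' Ut orbT.
Qed.

Lemma two_arcs c y s1 z s2 : good c -> c = y :: s1 ++ z :: s2 ->
  s1 != [::] -> s2 != [::] ->
  [/\ walk G s1 (next c y) (prev c z), walk G s2 (next c z) (prev c y),
      G y (next c y) /\ G (prev c z) z & G z (next c z) /\ G (prev c y) y].
Proof.
move=> gc Ec n1 n2; have U := good_uniq gc; case: gc => C _ _.
have Ec1 : c = [:: y] ++ (s1 ++ ([:: z] ++ s2)) by rewrite Ec.
have n3 : s1 ++ ([:: z] ++ s2) != [::] by case: (s1).
have cn : c != [::] by rewrite Ec.
have [a [b [w e]]] := cycle_walk C cn.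
rewrite Ec1 in w.
have [a1 [b1 [w1 w2 e1]]] := walk_catE w isT n3.
have [a2 [b2 [w3 w4 e2]]] := walk_catE w2 n1 isT.
have [a3 [b3 [w5 w6 e3]]] := walk_catE w4 isT n2.
case/walk1E: (w1) => ? ?; case/walk1E: (w5) => ? ?; subst a a1 b2 a3.
have N1 : next c y = b1 by rewrite Ec1; apply: walk_next w1 w2 _; rewrite -Ec1.
have N2 : next c b = y by rewrite Ec1; apply: walk_next_wrap w1 w2 _; rewrite -Ec1.
have Ec2 : c = ([:: y] ++ s1) ++ ([:: z] ++ s2) by rewrite -catA.
have w7 := walk_cat w1 w3 e1.
have N3 : next c a2 = z by rewrite Ec2; apply: walk_next w7 w4 _; rewrite -Ec2.
have Ec3 : c = (([:: y] ++ s1) ++ [:: z]) ++ s2 by rewrite -!catA.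
have w8 := walk_cat w7 w5 e2.
have N4 : next c z = b3 by rewrite Ec3; apply: walk_next w8 w6 _; rewrite -Ec3.
have P1 : prev c y = b by rewrite -N2 prev_next.
have P2 : prev c z = a2 by rewrite -N3 prev_next.
by rewrite N1 N4 P1 P2.
Qed.

(** Otherwise the edge from [y] to its successor could be replaced by a walk through [hs], giving a
    Hamiltonian cycle. *)
Lemma next_notin_X c y : good c -> y \in X -> next c y \notin X.
Proof.
move=> gc yX; apply/negP=> zX.
have U := good_uniq gc.
have yc : y \in c by case: gc => _ _; apply.
case: (rot_to yc) => i s E.
have g' := good_rot i gc; rewrite E in g'.
move: zX; rewrite -(next_rot i U) E.
have U' := good_uniq g'.
case: s E g' U' => [|z s] E g' U'.
  have : X \subset [set y].
    by apply/subsetP=> x; case: g' => _ _ /[apply]; rewrite !inE.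
  by move/subset_leq_card; rewrite cards1; move: X2; nat_lia.
rewrite /= eqxx => zX.
have yz : y != z by case/andP: U'; rewrite inE negb_or => /andP[].
have [hs' [a [b [P w e1 e2]]]] := Xlink yX zX yz.
case: (g') => C _ _.
have [a' [b' [w' e']]] := cycle_walk C isT.
have [a1 [b1 [/walk1E[? ?] w2 e3]]] := @walk_catE _ _ [:: y] (z :: s) _ _ w' isT isT.
subst a' a1; have ? := walk_headE w2; subst b1.
apply: (ham_false (s := hs' ++ (z :: s) ++ [:: y]) g').
- by apply: walk_cat w _ e2; apply: walk_cat w2 (walk1 _ _) e'.
- exact: e1.
- by perm_by_count P.
Qed.

Lemma prev_notin_X c y : good c -> y \in X -> prev c y \notin X.
Proof.
move=> gc yX; rewrite -(next_rev (good_uniq gc)).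
exact: next_notin_X (good_rev gc) yX.
Qed.

Lemma X_arcs c y s1 z s2 : good c -> c = y :: s1 ++ z :: s2 -> y \in X -> z \in X ->
  [/\ walk G s1 (next c y) (prev c z), walk G s2 (next c z) (prev c y),
      G y (next c y) /\ G (prev c z) z & G z (next c z) /\ G (prev c y) y].
Proof.
move=> gc E yX zX; apply: (two_arcs gc E).
- case: s1 E => //= E; have := next_notin_X gc yX.
  by rewrite E /= eqxx zX.
- case: s2 E => //= E; have := next_notin_X gc zX.
  rewrite E (_ : y :: s1 ++ [:: z] = rcons (y :: s1) z) ?next_rcons_cons ?yX ?cats1 //.
  by rewrite rcons_cons -cats1 -E (good_uniq gc).
Qed.

Lemma rot_two c y z : good c -> y \in X -> z \in X -> y != z ->
  exists i s1 s2, rot i c = y :: s1 ++ z :: s2.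
Proof.
move=> gc yX zX yz; have [_ _ S] := gc.
case: (rot_to_arc (good_uniq gc) (S _ yX) (S _ zX) yz) => i s1 s2 _ _ E.
by exists i, s1, s2.
Qed.

Lemma prev_rotE i c : good c -> prev (rot i c) =1 prev c.
Proof. by move=> gc; apply: prev_rot; exact: good_uniq. Qed.

Lemma next_rotE i c : good c -> next (rot i c) =1 next c.
Proof. by move=> gc; apply: next_rot; exact: good_uniq. Qed.

(** Otherwise there is a Hamiltonian cycle: from [y] through [hs] to [z], backwards to the successor
    of [y], across to the successor of [z], and forwards to [y]. *)
Lemma next_indep c y z : good c -> y \in X -> z \in X -> ~~ G (next c y) (next c z).
Proof.
move=> gc yX zX.
have [->|yz] := eqVneq y z; first by rewrite adj_irrefl.
have [i [s1 [s2 E]]] := rot_two gc yX zX yz.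
have g' := good_rot i gc.
have [w1 w2 [e1 e2] [e3 e4]] := X_arcs g' E yX zX.
rewrite -!(next_rotE i gc); apply/negP=> e.
have [hs' [a [b [P w e5 e6]]]] := Xlink yX zX yz.
apply: (ham_false (s := hs' ++ [:: z] ++ rev s1 ++ s2 ++ [:: y]) g').
- apply: walk_cat w _ e6; apply: walk_cat (walk1 _ _) _ _; last by rewrite adj_sym; exact: e2.
  by apply: walk_cat (walk_rev w1) _ e; apply: walk_cat w2 (walk1 _ _) e4.
- exact: e5.
- by rewrite E; perm_by_count P.
Qed.

Lemma prev_indep c y z : good c -> y \in X -> z \in X -> ~~ G (prev c y) (prev c z).
Proof.
by move=> gc yX zX; rewrite -!(next_rev (good_uniq gc)); apply: next_indep (good_rev gc) _ _.
Qed.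

(* If the two ends of a long arc between [y] and [z] were adjacent, the arc
   would close up into a cycle, and [hs] would close up the rest of [c]. *)
Lemma long_arc_ends c i y s1 z s2 : good c -> rot i c = y :: s1 ++ z :: s2 ->
  y \in X -> z \in X -> 2 < size s1 ->
  next c y != prev c z /\ ~~ G (next c y) (prev c z).
Proof.
move=> gc E yX zX sz.
have g' := good_rot i gc.
have [w1 w2 [e1 e2] [e3 e4]] := X_arcs g' E yX zX.
rewrite -(next_rotE i gc) -(prev_rotE i gc).
have U := good_uniq g'; rewrite E /= mem_cat inE cat_uniq !negb_or in U.
case/andP: U => /and3P[_ yz _] /and3P[U1 _ _].
split; first by apply: walk_neq w1 _ _; [|nat_lia].
apply/negP=> e.
have [hs' [a [b [P w e5 e6]]]] := Xlink yX zX yz.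
apply: (two_false (s := s1) (t := [:: z] ++ s2 ++ [:: y] ++ hs') g' w1) => //.
- by rewrite adj_sym.
- apply: walk_cat (walk1 _ _) _ e3.
  by apply: walk_cat w2 _ e4; apply: walk_cat (walk1 _ _) w e5.
- exact: e6.
- case: (s2) w2 => //= ? ? _; rewrite size_cat /=; nat_lia.
- by rewrite E; perm_by_count P.
Qed.

Lemma h0_nonadj c v : good c -> v \in c -> v \notin X -> ~~ G h0 v.
Proof.
move=> gc vc vX; apply: contra vX; apply: hsX => //; exact: good_notin_hs gc vc.
Qed.

Lemma next_in c y : good c -> y \in X -> next c y \in c.
Proof. by case=> _ _ S yX; rewrite mem_next S. Qed.

Lemma prev_in c y : good c -> y \in X -> prev c y \in c.
Proof. by case=> _ _ S yX; rewrite mem_prev S. Qed.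

Lemma next_set_indep c (Y : {set V}) : good c -> Y \subset X ->
  independent G [set next c w | w in Y].
Proof.
move=> gc /subsetP YX; apply/independentP=> _ _ /imsetP[x xY ->] /imsetP[y yY ->].
by apply: next_indep => //; exact: YX.
Qed.

Lemma card_next_set c (Y : {set V}) : good c -> #|[set next c w | w in Y]| = #|Y|.
Proof. by move=> gc; rewrite card_imset //; apply: can_inj (prev_next (good_uniq gc)). Qed.

Lemma card_prev_set c (Y : {set V}) : good c -> #|[set prev c w | w in Y]| = #|Y|.
Proof. by move=> gc; rewrite card_imset //; apply: can_inj (next_prev (good_uniq gc)). Qed.

(* Adding [h0] to an independent subset of [c] off [X] keeps it independent. *)
Lemma indep_off_X c (S : {set V}) : good c -> independent G S ->
  {in S, forall v, v \in c /\ v \notin X} -> #|S| <= #|X|.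
Proof.
move=> gc I H.
have hS : h0 \notin S by apply/negP=> /H[hc _]; have := good_notin_hs gc hc; rewrite h0hs.
have := @alphaX (h0 |: S); rewrite cardsU1 hS add1n ltnS; apply.
by apply: independentU1 => // y /H[yc yX]; exact: h0_nonadj gc yc yX.
Qed.

(** Otherwise [v], [v'] and the successors of [X :\ y] would be [#|X|.+1] independent vertices of
    [c] off [X], one more than [indep_off_X] allows. *)
Lemma adj_of_nonadj_next c y v v' : good c -> y \in X ->
  v \in c -> v \notin X -> v' \in c -> v' \notin X -> v != v' ->
  (forall w, w \in X -> w != y -> v != next c w /\ ~~ G v (next c w)) ->
  (forall w, w \in X -> w != y -> v' != next c w /\ ~~ G v' (next c w)) ->
  G v v'.
Proof.
move=> gc yX vc vX v'c v'X vv' H H'; apply: contraT => e.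
pose A := [set next c w | w in X :\ y].
have IA : independent G A by apply: next_set_indep gc _; exact: subD1set.
have vA : v \notin A.
  by apply/negP=> /imsetP[w]; rewrite !inE => /andP[wy wX] E; case: (H w wX wy); rewrite E eqxx.
have v'A : v' \notin A.
  by apply/negP=> /imsetP[w]; rewrite !inE => /andP[wy wX] E; case: (H' w wX wy); rewrite E eqxx.
have I1 : independent G (v' |: A).
  apply: independentU1 => // x /imsetP[w]; rewrite !inE => /andP[wy wX] ->.
  by case: (H' w wX wy).
have I2 : independent G (v |: (v' |: A)).
  apply: independentU1 => // x /setU1P[->//|/imsetP[w]].
  by rewrite !inE => /andP[wy wX] ->; case: (H w wX wy).
suff : #|v |: (v' |: A)| <= #|X|.
  rewrite !cardsU1 !inE (negbTE vv') (negbTE vA) (negbTE v'A) (card_next_set _ gc) /=.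
  rewrite (cardsD1 y X) yX; nat_lia.
apply: (indep_off_X gc I2) => x; rewrite !inE.
case/predU1P=> [->//|/predU1P[->//|/imsetP[w]]]; rewrite !inE => /andP[_ wX] ->.
by rewrite next_in // next_notin_X.
Qed.

(** The successors of [X] are [#|X|] independent vertices off [X], the most that is possible, so no
    vertex can be added to them. *)
Lemma next_dominates c y v : good c -> y \in X -> v \in c -> v \notin X ->
  exists2 w, w \in X & (v == next c w) || G v (next c w).
Proof.
move=> gc yX vc vX; apply/exists_inP; apply: contraT; rewrite negb_exists_in => /forall_inP H.
have := H _ yX; rewrite negb_or => /andP[n1 /negP []].
apply: (adj_of_nonadj_next gc yX vc vX) => //.
- exact: next_in.
- exact: next_notin_X.
- by move=> w wX _; apply/andP; rewrite -negb_or H.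
- move=> w wX wy; rewrite next_indep //.
  by rewrite (can_eq (prev_next (good_uniq gc))) eq_sym.
Qed.

Lemma prev_dominates c y v : good c -> y \in X -> v \in c -> v \notin X ->
  exists2 w, w \in X & (v == prev c w) || G v (prev c w).
Proof.
move=> gc yX vc vX.
have vr : v \in rev c by rewrite mem_rev.
have [w wX] := next_dominates (good_rev gc) yX vr vX.
by rewrite (next_rev (good_uniq gc)) => H; exists w.
Qed.

Lemma walk_lastE s x a b : walk G (rcons s x) a b -> b = x.
Proof. by move/walk_rev; rewrite rev_rcons => /walk_headE. Qed.

(** * Chord exchanges and long segments *)

Lemma good_neq c y s1 z s2 : good c -> c = y :: s1 ++ z :: s2 -> y != z.
Proof.
move=> /good_uniq + E; rewrite E /= mem_cat inE !negb_or.
by case/andP=> /and3P[].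
Qed.

(** The Hamiltonian cycle runs from [y] to [p], by a chord to the predecessor of [y], backwards to
    the successor of [w], by a chord to [q], on to [w], and through [hs] to [y]. *)
Lemma crossing_chords c y I1 p q I2 w r : good c ->
  c = y :: (rcons I1 p ++ q :: I2) ++ w :: r -> y \in X -> w \in X ->
  G p (prev c y) -> G q (next c w) -> False.
Proof.
move=> gc E yX wX e1 e2.
have yw := good_neq gc E.
have [w1 w2 [e3 e4] [e5 e6]] := X_arcs gc E yX wX.
have [p' [q' [w3 w4 _]]] := walk_catE w1 (rcons_nnil _ _) isT.
have ? := walk_lastE w3; have ? := walk_headE w4; subst p' q'.
have [hs' [a [b [P w' e7 e8]]]] := Xlink wX yX (neq_sym yw).
apply: (ham_false (s := [:: y] ++ rcons I1 p ++ rev r ++ (q :: I2) ++ [:: w] ++ hs') gc).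
- apply: walk_cat (walk1 _ _) _ e3; apply: walk_cat w3 _ e1.
  apply: walk_cat (walk_rev w2) _ _; last by rewrite adj_sym; exact: e2.
  by apply: walk_cat w4 _ e4; apply: walk_cat (walk1 _ _) w' e7.
- exact: e8.
- by rewrite E; perm_by_count P.
Qed.

(** The first chord closes the arc from the successor of [y] to [p]. The other cycle runs from [y]
    through [hs] to [w], backwards to [q], by the second chord to the successor of [w], and on to
    [y]. *)
Lemma split_initial_cycle c y Q p q J w r : good c ->
  c = y :: (rcons Q p ++ q :: J) ++ w :: r -> y \in X -> w \in X ->
  1 < size Q -> G (next c y) p -> G q (next c w) -> False.
Proof.
move=> gc E yX wX sz e1 e2.
have yw := good_neq gc E.
have [w1 w2 [e3 e4] [e5 e6]] := X_arcs gc E yX wX.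
have [p' [q' [w3 w4 _]]] := walk_catE w1 (rcons_nnil _ _) isT.
have ? := walk_lastE w3; have ? := walk_headE w4; subst p' q'.
have [hs' [a [b [P w' e7 e8]]]] := Xlink yX wX yw.
apply: (two_false (s := rcons Q p) (t := [:: y] ++ hs' ++ [:: w] ++ rev (q :: J) ++ r) gc w3).
- by rewrite adj_sym.
- by rewrite size_rcons.
- apply: walk_cat (walk1 _ _) _ e7; apply: walk_cat w' _ e8.
  apply: (walk_cat (walk1 _ _)); last by rewrite adj_sym; exact: e4.
  by apply: walk_cat (walk_rev w4) w2 e2.
- exact: e6.
- rewrite /= !size_cat /= size_cat size_rev /=; nat_lia.
- by rewrite E; perm_by_count P.
Qed.

(** The second chord closes the arc from [q] to the predecessor of [w]. The other cycle runs from
    [w] to the predecessor of [y], by the first chord to [u], then to [y] and through [hs] to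
    [w]. *)
Lemma split_final_cycle c y u q s w r : good c ->
  c = y :: (u :: q :: s) ++ w :: r -> y \in X -> w \in X ->
  1 < size s -> G u (prev c y) -> G q (prev c w) -> False.
Proof.
move=> gc E yX wX sz e1 e2.
have yw := good_neq gc E.
have [w1 w2 [e3 e4] [e5 e6]] := X_arcs gc E yX wX.
have [u' [q' [w3 w4 _]]] := @walk_catE _ _ [:: u] (q :: s) _ _ w1 isT isT.
have [? ?] := walk1E w3; have ? := walk_headE w4; subst u' q'.
have [hs' [a [b [P w' e7 e8]]]] := Xlink yX wX yw.
apply: (two_false (s := q :: s) (t := [:: w] ++ r ++ [:: u] ++ [:: y] ++ hs') gc w4).
- by rewrite adj_sym.
- by [].
- apply: (walk_cat (walk1 _ _) _ e5); apply: (walk_cat w2); last by rewrite adj_sym; exact: e1.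
  apply: (walk_cat (walk1 _ _)); last by rewrite adj_sym -(walk_headE w1); exact: e3.
  by apply: walk_cat (walk1 _ _) w' e7.
- exact: e8.
- rewrite /= !size_cat /=; nat_lia.
- by rewrite E; perm_by_count P.
Qed.

(** The arc of [c] from [w] to [z] contains [I], so [long_arc_ends] applies to it. *)
Lemma far_next c y I z r w : good c -> c = y :: I ++ z :: r -> y \in X -> z \in X ->
  {in I, forall v, v \notin X} -> 2 < size I -> w \in X -> w != z ->
  next c w != prev c z /\ ~~ G (next c w) (prev c z).
Proof.
move=> gc E yX zX IX sz wX wz.
have : w \in c by case: gc => _ _; apply.
rewrite {1}E inE mem_cat inE (negbTE wz) /=; case/or3P=> [/eqP->|/IX|wr].
- by apply: (@long_arc_ends c 0 y I z r); rewrite ?rot0.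
- by rewrite wX.
case/splitPr: wr E => r1 r2 E.
apply: (@long_arc_ends c (size (y :: I ++ z :: r1)) w (r2 ++ y :: I) z r1) => //.
  by rewrite E -cat_cons -[z :: _ ++ _]/((z :: r1) ++ _) catA rot_size_cat /= -!catA.
by rewrite size_cat /=; nat_lia.
Qed.

Lemma far_prev c y I z r w : good c -> c = y :: I ++ z :: r -> y \in X -> z \in X ->
  {in I, forall v, v \notin X} -> 2 < size I -> w \in X -> w != y ->
  next c y != prev c w /\ ~~ G (next c y) (prev c w).
Proof.
move=> gc E yX zX IX sz wX wy.
have : w \in c by case: gc => _ _; apply.
rewrite {1}E inE mem_cat inE (negbTE wy) /=; case/or3P=> [/IX|/eqP->|wr].
- by rewrite wX.
- by apply: (@long_arc_ends c 0 y I z r); rewrite ?rot0.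
case/splitPr: wr E => r1 r2 E.
apply: (@long_arc_ends c 0 y (I ++ z :: r1) w r2) => //; first by rewrite rot0 E -catA.
by rewrite size_cat /=; nat_lia.
Qed.

Lemma good_size c y I z r : good c -> c = y :: I ++ z :: r -> 2 < size I ->
  forall w, w \in c -> next c w != prev c w.
Proof.
move=> gc E sz w wc; apply: next_neq_prev => //; first exact: good_uniq gc.
by rewrite E /= size_cat /=; nat_lia.
Qed.

(** Domination forces chords over [y] and over [z]. Given these, the listed edges at [u2] would
    produce covering cycles, and with a fourth vertex in the segment nothing would be left to
    dominate [u2]. *)
Lemma long_segment c y I z r : good c -> c = y :: I ++ z :: r -> y \in X -> z \in X ->
  {in I, forall v, v \notin X} -> 2 < size I ->
  exists u1 u2 u3, [/\ I = [:: u1; u2; u3], G u1 (prev c y), G u3 (next c z),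
    {in X, forall w, w != y -> ~~ G u2 (next c w)} &
    {in X, forall w, w != z -> ~~ G u2 (prev c w)}].
Proof.
move=> gc E yX zX IX sz.
have U := good_uniq gc.
have Xc : {subset X <= c} by case: gc.
have [w1 w2 [e1 e2] [e3 e4]] := X_arcs gc E yX zX.
case: I E IX sz w1 => [|u1 [|u2 [|u3 I']]] // E IX sz w1.
have a_y := walk_headE w1.
have Ic v : v \in [:: u1, u2, u3 & I'] -> v \in c.
  by move=> vI; rewrite E inE mem_cat vI orbT.
(* Some successor of [X] dominates the predecessor of [z], and [far_next] excludes all but that of
   [z]. *)
have M1 : G (prev c z) (next c z).
  have [w wX] := next_dominates gc yX (prev_in gc zX) (prev_notin_X gc zX).
  have [->|wz] := eqVneq w z.
    by rewrite eq_sym (negbTE (good_size gc E sz (Xc _ zX))).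
  have [n1 n2] := far_next gc E yX zX IX sz wX wz.
  by rewrite eq_sym (negbTE n1) adj_sym (negbTE n2).
have M2 : G u1 (prev c y).
  rewrite -a_y; have [w wX] := prev_dominates gc yX (next_in gc yX) (next_notin_X gc yX).
  have [->|wz] := eqVneq w y; first by rewrite (negbTE (good_size gc E sz (Xc _ yX))).
  have [n1 n2] := far_prev gc E yX zX IX sz wX wz.
  by rewrite (negbTE n1) (negbTE n2).
have after w : w \in X -> w != y ->
    exists I2 r', c = y :: ([:: u1, u2, u3 & I'] ++ I2) ++ w :: r' /\ (w != z -> I2 != [::]).
  move=> wX wy; have := Xc _ wX.
  rewrite {1}E inE mem_cat inE (negbTE wy) /=; case/or3P=> [/IX|/eqP->|wr].
  - by rewrite wX.
  - by exists [::], r; rewrite cats0 eqxx.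
  case/splitPr: wr E => r1 r2 E.
  by exists (z :: r1), r2; rewrite E -catA.
have notnext v w : v \in [:: u2, u3 & I'] -> w \in X -> v != next c w.
  move=> vJ wX; apply/eqP=> Ev.
  have [p pI Np] := next_in_seg U E vJ.
  have /IX : p \in [:: u1, u2, u3 & I'] by [].
  by rewrite (can_inj (prev_next U) (etrans Np Ev)) wX.
(* Such an edge would cross the chord at [u1] given by [M2]. *)
have M3 : {in X, forall w, w != y -> ~~ G u2 (next c w)}.
  move=> w wX wy; apply/negP=> e.
  have [I2 [r' [E' _]]] := after w wX wy.
  exact: (@crossing_chords c y [::] u1 u2 ([:: u3 & I'] ++ I2) w r').
pose ha v := [exists w in X, (w != y) && G v (next c w)].
have haP : has ha (u3 :: I').
  apply/hasP; exists (prev c z).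
    by case/and3P: w1 => _ /eqP <- _; exact: (mem_last u3 I').
  by apply/exists_inP; exists z; rewrite // M1 andbT eq_sym (good_neq gc E).
(* Take the first [x] from [u3] on that satisfies [ha]. If it is not [u3], its predecessor [p] fails
   [ha], so [u1] and [p] are adjacent by [adj_of_nonadj_next], which [split_initial_cycle]
   forbids. *)
have [w3 [w3X w3y w3e]] : exists w, [/\ w \in X, w != y & G u3 (next c w)].
  have [Q [x [J [EQ /exists_inP[w wX /andP[wy e]] nQ]]]] := has_first haP.
  case/lastP: Q EQ nQ => [[-> _] _|Q p EQ nQ]; first by exists w.
  have pI : p \in u3 :: I' by rewrite EQ mem_cat mem_rcons inE eqxx.
  have pJ : p \in [:: u2, u3 & I'] by rewrite inE pI orbT.
  have pI' : p \in [:: u1, u2, u3 & I'] by rewrite inE pJ orbT.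
  have [I2 [r' [E' _]]] := after w wX wy; rewrite EQ in E'.
  case: (@split_initial_cycle c y [:: u1, u2 & Q] p x (J ++ I2) w r') => //.
    by rewrite E' /= -!catA /= -catA.
  rewrite a_y; have u1I : u1 \in [:: u1, u2, u3 & I'] by rewrite inE eqxx.
  apply: (adj_of_nonadj_next gc yX (Ic _ u1I) (IX _ u1I) (Ic _ pI') (IX _ pI')).
  - apply/eqP=> up; move: U; rewrite E /= => /and3P[_ +  _].
    by rewrite up -cat_cons -cat_cons mem_cat pJ.
  - move=> v vX vy; rewrite -a_y next_indep //.
    by rewrite (can_eq (prev_next U)) eq_sym.
  - move=> v vX vy; rewrite notnext //; split=> //.
    apply: contra nQ => ev; apply/hasP; exists p; first by rewrite mem_rcons inE eqxx.
    by apply/exists_inP; exists v; rewrite // vy.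
have Nu2 : next c u2 = u3.
  have E' : c = rcons [:: y; u1] u2 ++ u3 :: (I' ++ z :: r) by rewrite E.
  by rewrite E' next_cat_head // -E'.
have M5 : ~~ G u2 (prev c y).
  apply/negP=> e; have [I2 [r' [E' _]]] := after w3 w3X w3y.
  exact: (@crossing_chords c y [:: u1] u2 u3 (I' ++ I2) w3 r').
(* The cycle split off starts with [u2] and [u3] and needs a third vertex, from [I2] if [w != z] and
   from [I'] otherwise. *)
have M6 w : w \in X -> (w != z) || (0 < size I') -> ~~ G u2 (prev c w).
  move=> wX H; have [->//|wy] := eqVneq w y.
  have [I2 [r' [E' n]]] := after w wX wy; apply/negP=> e.
  apply: (@split_final_cycle c y u1 u2 (u3 :: I' ++ I2) w r') => //.
  rewrite /= size_cat; case/orP: H => [/n|]; last by nat_lia.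
  by case: (I2) => //= *; nat_lia.
case: I' E IX sz w1 Ic after notnext haP M6 => [|u4 I'] E IX sz w1 Ic after notnext haP M6.
  exists u1, u2, u3; split=> //.
    by case/and3P: w1 M1 => _ /eqP/= <-.
  by move=> w wX wz; apply: M6; rewrite ?wz.
(* With a fourth vertex [M6] holds on all of [X], so [u2] could only be itself a predecessor of [X];
   but its successor is [u3]. *)
have u2I : u2 \in [:: u1, u2, u3, u4 & I'] by rewrite !inE eqxx orbT.
have [w wX] := prev_dominates gc yX (Ic _ u2I) (IX _ u2I).
rewrite (negbTE (M6 w wX _)) ?orbT // orbF => /eqP Ew.
have := next_prev U w; rewrite -Ew Nu2 => Ew'.
have /IX : u3 \in [:: u1, u2, u3, u4 & I'] by rewrite !inE eqxx !orbT.
by rewrite Ew' wX.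
Qed.

(** The vertices at distance at least two from [X] along [c]; they turn out to be the middles of
    segments of three vertices. *)
Definition inner c v := [&& v \in c, v \notin X, next c v \notin X & prev c v \notin X].

Lemma inner_segment c v : good c -> inner c v -> exists c' y u1 u3 z r,
  [/\ [/\ good c', next c' =1 next c & prev c' =1 prev c],
      c' = y :: [:: u1; v; u3] ++ z :: r,
      [/\ y \in X, z \in X & {in [:: u1; v; u3], forall u, u \notin X}],
      G u1 (prev c y) /\ G u3 (next c z) &
      {in X, forall w, w != y -> ~~ G v (next c w)} /\
      {in X, forall w, w != z -> ~~ G v (prev c w)}].
Proof.
move=> gc /and4P[vc vX nX pX]; have U := good_uniq gc.
case: (rot_to vc) => i s Es.
have gs := good_rot i gc; rewrite Es in gs.
have Xs x : x \in X -> x \in s.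
  move=> xX; case: (gs) => _ _ /(_ x xX); rewrite inE => /predU1P[Ex|//].
  by rewrite -Ex xX in vX.
have [x0 x0X] : exists x, x \in X by apply/set0Pn; rewrite -card_gt0; nat_lia.
have /has_first[I2 [z [s' [E1 zX n1]]]] : has (mem X) s.
  by apply/hasP; exists x0 => //; exact: Xs.
have /has_first[R1 [y [R2 [E2 yX n2]]]] : has (mem X) (rev s').
  have [x1 x1X] : exists x, x \in X :\ z.
    apply/set0Pn; rewrite -card_gt0; move: X2; rewrite (cardsD1 z) (_ : z \in X) //; nat_lia.
  case/setD1P: x1X => x1z x1X; apply/hasP; exists x1 => //.
  rewrite mem_rev; have := Xs _ x1X; rewrite E1 mem_cat inE (negbTE x1z) /=.
  by case/orP=> // x1I; case/hasP: n1; exists x1.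
have {}zX : z \in X := zX; have {}yX : y \in X := yX.
have E3 : s' = rev R2 ++ y :: rev R1 by rewrite -[s']revK E2 rev_cat rev_cons cat_rcons.
pose c' := y :: (rev R1 ++ v :: I2) ++ z :: rev R2.
have Ec' : c' = rot (size (v :: I2 ++ z :: rev R2)) (rot i c).
  have -> : rot i c = (v :: I2 ++ z :: rev R2) ++ y :: rev R1 by rewrite Es E1 E3 /= -!catA.
  by rewrite rot_size_cat /c' /= -!catA.
have g' : good c' by rewrite Ec'; do 2!apply: good_rot.
have Nc' : next c' =1 next c by move=> x; rewrite Ec' !next_rot // rot_uniq.
have Pc' : prev c' =1 prev c by move=> x; rewrite Ec' !prev_rot // rot_uniq.
have I2n : I2 != [::].
  move: nX; rewrite -(next_rotE i gc) Es E1; case: (I2) => //=.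
  by rewrite eqxx zX.
have R1n : R1 != [::].
  apply: contraNneq pX => R1n; rewrite -Pc'.
  suff -> : prev c' v = y by [].
  have -> : v = next c' y by rewrite /c' R1n /= eqxx.
  by rewrite prev_next // (good_uniq g').
have IX : {in rev R1 ++ v :: I2, forall u, u \notin X}.
  move=> u; rewrite mem_cat mem_rev inE => /or3P[uR|/eqP->//|uI].
    by apply: contra n2 => uX; apply/hasP; exists u.
  by apply: contra n1 => uX; apply/hasP; exists u.
have sz : 2 < size (rev R1 ++ v :: I2).
  rewrite size_cat size_rev /=; case: (R1) R1n => // ? ? _; case: (I2) I2n => // ? ? _ /=; nat_lia.
have [u1 [u2 [u3 [EI e1 e3 H1 H2]]]] := long_segment g' erefl yX zX IX sz.
(* Both sides of [v] in the segment are nonempty, so [v] is the middle one of the three. *)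
have ? : u2 = v.
  case: (lastP R1) R1n EI => // R w _; rewrite rev_rcons => -[_].
  case: (rev R) => [|? [|? [|??]]] //=; first by case.
  by case=> _ _; case: (I2) I2n.
subst u2; exists c', y, u1, u3, z, (rev R2).
split=> //; first by rewrite /c' EI.
- by split=> // u; rewrite -EI; exact: IX.
- by rewrite -Pc' -Nc'.
- by split=> w wX; rewrite -?Nc' -?Pc'; [exact: H1|exact: H2].
Qed.

(* Two inner vertices [v] and [v'] would give the independent set formed by
   [h0], [v], the successors of the vertices of [X] between [v] and [v'], and
   the predecessors of those between [v'] and [v]. *)
Lemma inner_uniq c0 v v' : good c0 -> inner c0 v -> inner c0 v' -> v = v'.
Proof.
move=> gc0 b0 b0'.
have [c [y [u1 [u3 [z [r [[gc Nc Pc] E [yX zX IX] _ [H1 H2]]]]]]]] := inner_segment gc0 b0.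
have bv : inner c v by rewrite /inner Nc Pc (good_mem _ gc) -(good_mem _ gc0).
have bv' : inner c v' by rewrite /inner Nc Pc (good_mem _ gc) -(good_mem _ gc0).
have {}H1 : {in X, forall w, w != y -> ~~ G v (next c w)} by move=> w; rewrite Nc; exact: H1.
have {}H2 : {in X, forall w, w != z -> ~~ G v (prev c w)} by move=> w; rewrite Pc; exact: H2.
apply: contraTeq isT => vv'.
case/and4P: bv => vc vX nX pX; case/and4P: bv' => v'c v'X n'X p'X.
have U := good_uniq gc.
have Nu3 : next c u3 = z.
  have E' : c = rcons [:: y; u1; v] u3 ++ z :: r by rewrite E.
  by rewrite E' next_cat_head // -E'.
have Nu1 : prev c u1 = y.
  have -> : u1 = next c y by rewrite E /= eqxx.
  exact: prev_next.
have v'r : v' \in r.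
  move: v'c; rewrite E /= !inE (eq_sym v' v) (negbTE vv') /=.
  case/or4P=> [/eqP v'y|/eqP v'u|/eqP v'u|/orP[/eqP v'z|//]].
  - by rewrite v'y yX in v'X.
  - by rewrite v'u Nu1 yX in p'X.
  - by rewrite v'u Nu3 zX in n'X.
  - by rewrite v'z zX in v'X.
case/splitPr: v'r E => r1 r2 E.
have [r1' [p E1]] : exists r1' p, r1 = rcons r1' p.
  case/lastP: r1 E => [|r1' p] E; last by exists r1', p.
  case/negP: p'X; suff -> : v' = next c z by rewrite prev_next.
  have E' : c = rcons [:: y; u1; v; u3] z ++ v' :: r2 by rewrite E.
  by rewrite E' next_cat_head // -E'.
have Pp : prev c v' = p.
  suff <- : next c p = v' by rewrite prev_next.
  have E' : c = rcons [:: y, u1, v, u3, z & r1'] p ++ v' :: r2 by rewrite E E1 /= !cat_rcons.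
  by rewrite E' next_cat_head // -E'.
have [q [r2' E2]] : exists q r2', r2 = q :: r2'.
  case: r2 E => [|q r2'] E; last by exists q, r2'.
  case/negP: n'X; suff -> : next c v' = y by [].
  have E' : c = rcons (y :: [:: u1, v, u3, z & r1]) v' by rewrite E /= cats1.
  by rewrite E' next_rcons_cons // -E'.
have Nq : next c v' = q.
  have E' : c = rcons [:: y, u1, v, u3, z & r1] v' ++ q :: r2' by rewrite E E2 /= !cat_rcons.
  by rewrite E' next_cat_head // -E'.
rewrite Pp in p'X; rewrite Nq in n'X.
(* Read from [u1], the cycle consists of the segment of [v], then [P] starting at [z], then [p],
   [v'], [q], then [Q] ending at [y]. *)
pose P := z :: r1'; pose Q := rcons r2' y.
pose d := [:: u1; v; u3] ++ P ++ [:: p; v'; q] ++ Q.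
have Ed : rot 1 c = d by rewrite E E1 E2 rot1_cons /d /P /Q /= !cat_rcons rcons_cat.
have gd : good d by rewrite -Ed; exact: good_rot.
have Nd : next d =1 next c by move=> x; rewrite -Ed next_rot.
have Pd : prev d =1 prev c by move=> x; rewrite -Ed prev_rot.
(* An arc from [P] to [Q] contains [p], [v'] and [q], so it is long. *)
have far w w' : w \in X -> w' \in X -> w \in P -> w' \in Q ->
    next c w != prev c w' /\ ~~ G (next c w) (prev c w').
  move=> wX w'X wP w'Q; rewrite -Nd -Pd.
  have [l1 [l2 EP]] := mem_split wP; have [m1 [m2 EQ]] := mem_split w'Q.
  apply: (@long_arc_ends d (size ([:: u1; v; u3] ++ l1)) w (l2 ++ [:: p; v'; q] ++ m1) w'
            (m2 ++ [:: u1; v; u3] ++ l1)) => //.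
    rewrite /d EP EQ -(catA l1) (catA [:: u1; v; u3]) rot_size_cat.
    by do 4!rewrite /= -?catA.
  by rewrite !size_cat /=; nat_lia.
have Ud := good_uniq gd.
have dis w : w \in P -> w \in Q -> False.
  move=> wP wQ; move: Ud; rewrite /d catA cat_uniq => /and3P[_ /hasPn/(_ w) H _].
  by move: H; rewrite !mem_cat wP wQ !orbT => /(_ isT).
pose XP := [set w in X | w \in P]; pose XQ := X :\: XP.
have XQQ w : w \in XQ -> w \in Q.
  case/setDP=> wX; rewrite inE wX /= => wP.
  case: (gd) => _ _ /(_ w wX); rewrite /d !mem_cat (negbTE wP) /=.
  case/or3P=> // [/IX|]; first by rewrite wX.
  by rewrite !inE => /or3P[] /eqP Ew; rewrite Ew ?(negbTE p'X) ?(negbTE v'X) ?(negbTE n'X) in wX.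
pose S1 := [set next c w | w in XP]; pose S2 := [set prev c w | w in XQ].
have XPE w : w \in XP -> w \in X /\ w \in P by rewrite inE => /andP.
have XQE w : w \in XQ -> w \in X /\ w \in Q by move=> wQ; rewrite (XQQ _ wQ); case/setDP: wQ.
have I12 : independent G (S1 :|: S2).
  apply/independentP=> a b; rewrite !inE.
  case/orP=> /imsetP[w] + ->; [move/XPE=> [wX wP]|move/XQE=> [wX wP]];
  case/orP=> /imsetP[w'] + ->; [move/XPE=> [w'X w'P]|move/XQE=> [w'X w'P]
    |move/XPE=> [w'X w'P]|move/XQE=> [w'X w'P]].
  - exact: next_indep.
  - by case: (far w w').
  - by rewrite adj_sym; case: (far w' w).
  - exact: prev_indep.
have zP : z \in P by rewrite inE eqxx.
have yQ : y \in Q by rewrite mem_rcons inE eqxx.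
have IS : independent G (v |: (S1 :|: S2)).
  apply: independentU1 => // a; rewrite !inE.
  case/orP=> /imsetP[w] + ->; [move/XPE=> [wX wP]|move/XQE=> [wX wQ]].
    apply: H1 => //; apply/eqP=> wy; apply: (dis w) => //; by rewrite wy.
  apply: H2 => //; apply/eqP=> wz; apply: (dis w) => //; by rewrite wz.
have vS : v \notin S1 :|: S2.
  rewrite !inE negb_or; apply/andP; split; apply/negP=> /imsetP[w].
    by move/XPE=> [wX _] Ev; move: pX; rewrite Ev prev_next // wX.
  by move/XQE=> [wX _] Ev; move: nX; rewrite Ev next_prev // wX.
have S12 : [disjoint S1 & S2].
  rewrite -setI_eq0; apply/eqP/setP=> a; rewrite !inE; apply/negbTE/negP.
  case/andP=> /imsetP[w /XPE[wX wP] ->] /imsetP[w' /XQE[w'X w'Q] /eqP].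
  by case: (far w w') => // /negbTE->.
(* As [XP] and [XQ] partition [X], this set has [#|X|.+1] elements. *)
suff : #|v |: (S1 :|: S2)| <= #|X|.
  rewrite cardsU1 vS cardsU (disjoint_setI0 S12) cards0 subn0.
  rewrite (card_next_set _ gc) (card_prev_set _ gc) -(cardsID XP X).
  rewrite (_ : X :&: XP = XP) ?ltnn //; apply/setP=> w; rewrite !inE.
  by case: (w \in X).
apply: (indep_off_X gc IS) => a; rewrite !inE.
case/or3P=> [/eqP->//||] /imsetP[w] + ->; [move/XPE=> [wX wP]|move/XQE=> [wX wP]].
  by rewrite next_in ?next_notin_X.
by rewrite prev_in ?prev_notin_X.
Qed.

(** A vertex that is not inner lies in [X], among its successors or among its predecessors, and each
    of these sets has at most [#|X|] elements. *)
Lemma card_inner c : good c ->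
  size c <= 3 * #|X| + #|[set v | inner c v]|.
Proof.
move=> gc; have U := good_uniq gc.
rewrite -(card_uniqP U).
pose A := [set next c w | w in X]; pose B := [set prev c w | w in X].
apply: (@leq_trans #|X :|: A :|: B :|: [set v | inner c v]|).
  apply/subset_leq_card/subsetP=> v vc; rewrite !inE /inner (_ : v \in c) //=.
  have [//|vX /=] := boolP (v \in X).
  have [nX|nX] := boolP (next c v \in X).
    by rewrite (_ : v \in B) ?orbT //; apply/imsetP; exists (next c v); rewrite ?prev_next.
  have [pX|pX] := boolP (prev c v \in X).
    by rewrite (_ : v \in A) //; apply/imsetP; exists (prev c v); rewrite ?next_prev.
  by rewrite !orbT.
apply: leq_trans (leq_card_setU _ _) _; rewrite leq_add2r.
apply: leq_trans (leq_card_setU _ _) _; rewrite (card_prev_set _ gc).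
have [+ _] := leq_card_setU X A; rewrite (card_next_set _ gc); nat_lia.
Qed.

(** * The tight case: one inner vertex and two vertices in [hs] *)

Hypothesis large : 3 * #|X| + 3 <= #|V|.
Hypothesis hs_small : size hs <= 2.
Hypothesis hs_deg : forall h, h \in hs -> #|X| <= degree G h.

(** The triangle on [t], [h1], [h2] and the cycle [c] with [t] bypassed by the chord would cover the
    graph. *)
Lemma no_bypassed_triangle c h1 h2 t : good c -> perm_eq [:: h1; h2] hs -> G h1 h2 ->
  t \in X -> G (next c t) (prev c t) -> G t h1 -> G t h2 -> False.
Proof.
move=> gc P e12 tX e e1 e2.
(* The second vertex [t'] only serves to cut [c] open at [t] by [X_arcs]. *)
have [t' t'X tt'] : exists2 t', t' \in X & t != t'.
  have [t' /setD1P[t't t'X]] : exists x, x \in X :\ t.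
    apply/set0Pn; rewrite -card_gt0; move: X2; rewrite (cardsD1 t) tX; nat_lia.
  by exists t'; rewrite // eq_sym.
have [i [s1 [s2 E]]] := rot_two gc tX t'X tt'.
have g' := good_rot i gc.
have [w1 w2 [e3 e4] [e5 e6]] := X_arcs g' E tX t'X.
rewrite -(next_rotE i gc) -(prev_rotE i gc) in e.
apply: (two_false (s := [:: t; h1; h2]) (t := s1 ++ [:: t'] ++ s2) (a := t) (b := h2) g') => //.
- by rewrite /= !eqxx e1 e12.
- by rewrite adj_sym.
- by apply: walk_cat w1 _ e4; apply: walk_cat (walk1 _ _) w2 e5.
- by rewrite adj_sym.
- case: (s1) w1 => // ? ? _; case: (s2) w2 => // ? ? _; rewrite size_cat /=; nat_lia.
- by rewrite E; perm_by_count P.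
Qed.

(** All neighbours of [h1] lie in [h2 |: (X :\ y)], which has [#|X|] elements, no more than the
    degree of [h1]; so each of these is a neighbour. *)
Lemma neighbours_in_X h1 h2 y : perm_eq [:: h1; h2] hs -> h2 \notin X -> y \in X ->
  ~~ G h1 y -> {in X, forall t, t != y -> G h1 t}.
Proof.
move=> P h2X yX n t tX ty.
have h1hs : h1 \in hs by rewrite -(perm_mem P) inE eqxx.
have sub : [set v | G h1 v] \subset h2 |: (X :\ y).
  apply/subsetP=> v; rewrite !inE => e; have [vh|vh] := boolP (v \in hs).
    move: vh; rewrite -(perm_mem P) !inE => /orP[/eqP vh|->//].
    by rewrite vh adj_irrefl in e.
  rewrite (hsX h1hs vh e) andbT.
  by rewrite (_ : v != y) ?orbT //; apply: contraNneq n => <-.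
have/eqP Es : [set v | G h1 v] == h2 |: (X :\ y).
  rewrite eqEcard sub cardsU1 !inE (negbTE h2X) andbF /=.
  have := hs_deg h1hs; rewrite /degree (cardsD1 y X) yX; nat_lia.
by move/setP/(_ t): Es; rewrite !inE tX ty orbT.
Qed.

Lemma spanning_mod_hs_false c0 : good c0 -> False.
Proof.
move=> gc0.
have szc0 := good_size_cat gc0.
have U0 := good_uniq gc0.
have card_in : #|[set v | inner c0 v]| <= 1.
  by apply/card_le1P=> v; rewrite inE => bv w; rewrite inE; apply/idP/eqP=> [/(inner_uniq gc0 bv)|->].
have card_c := card_inner gc0.
(* At most one inner vertex and two vertices in [hs] give at most [3 * #|X| + 3] vertices, so
   equality holds throughout. *)
have [v bv] : exists v, inner c0 v.
  have : 0 < #|[set v | inner c0 v]| by nat_lia.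
  by rewrite card_gt0 => /set0Pn[v]; rewrite inE; exists v.
have szc : size c0 = 3 * #|X| + 1 by nat_lia.
have szh : size hs = 2 by nat_lia.
have [c [y [u1 [u3 [z [r [[gc Nc Pc] E [yX zX IX] [e1 e3] _]]]]]]] := inner_segment gc0 bv.
rewrite -Pc -Nc in e1 e3.
have U := good_uniq gc.
have szcc : size c = 3 * #|X| + 1.
  by have := good_size_cat gc; nat_lia.
have [w1 w2 [d1 d2] [d3 d4]] := X_arcs gc E yX zX.
have yz := good_neq gc E.
have Ny : next c y = u1 by exact: walk_headE w1.
have Pz : prev c z = u3 by case/and3P: w1 => _ /eqP/= <-.
have [hs' [h1 [h2 [P wh eh1 eh2]]]] := Xlink yX zX yz.
have Eh : hs' = [:: h1; h2].
  move: (perm_size P) wh; rewrite szh; case: hs' {P} => [|a [|b [|]]] //= _.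
  by case/and3P=> /eqP-> /eqP->.
subst hs'.
have e12 : G h1 h2 by case/and3P: wh => _ _ /=; rewrite andbT.
have P' : perm_eq [:: h2; h1] hs by perm_by_count P.
have hX h : h \in hs -> h \notin X.
  by move=> hh; apply/negP=> hX; case: (gc) => _ _ /(_ h hX); rewrite (good_mem _ gc) hh.
have h1X : h1 \notin X by apply: hX; rewrite -(perm_mem P) inE eqxx.
have h2X : h2 \notin X by apply: hX; rewrite -(perm_mem P') inE eqxx.
(* Since [y] is adjacent to [h1], a second edge to [h2] would give a triangle that [e1] bypasses;
   likewise at [z]. Hence [h1] misses only [z] in [X], and [h2] only [y]. *)
have n2 : ~~ G h2 y.
  rewrite adj_sym; apply/negP=> e; apply: (no_bypassed_triangle gc P e12 yX) => //.
  by rewrite Ny.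
have n1 : ~~ G h1 z.
  rewrite adj_sym; apply/negP=> e; apply: (no_bypassed_triangle gc P e12 zX) => //.
    by rewrite Pz adj_sym.
  by rewrite adj_sym.
have a1 := neighbours_in_X P h2X zX n1.
have a2 := neighbours_in_X P' h1X yX n2.
(* With no vertex of [X] in [r], the set [X] is [[set y; z]] and [c] has seven vertices, so a
   Hamiltonian cycle can be written down. Otherwise let [t] be the first vertex of [X] after [z]. *)
have [hr|hr] := boolP (has (mem X) r); last first.
  have EX : X = [set y; z].
    apply/setP=> x; rewrite !inE; apply/idP/idP=> [xX|/orP[] /eqP->//].
    case: (gc) => _ _ /(_ x xX); rewrite {1}E inE mem_cat inE.
    case/or4P=> [->//|/IX|->|xr]; rewrite ?xX ?orbT //.
    by case/hasP: hr; exists x.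
  have szr : size r = 2 by move: szcc; rewrite EX cards2 yz E /=; nat_lia.
  case: r szr E w2 hr => [|a [|b []]] // _ E w2 hr.
  case/and3P: w2 => /eqP Ea /eqP/= Eb _; rewrite -Ea -Eb in e1 e3 d3 d4.
  apply: (ham_false (s := [:: y; b] ++ [:: u1; v; u3] ++ [:: a; z] ++ [:: h2; h1])
           (a := y) (b := h1) gc).
  - rewrite /= !eqxx (adj_sym _ y b) d4 (adj_sym _ b) e1 e3 (adj_sym _ a) d3 (adj_sym _ z) eh2.
    rewrite (adj_sym _ h2) e12 /= !andbT.
    by case/and3P: w1 => _ _ /=; rewrite andbT.
  - by rewrite adj_sym.
  - by rewrite E; perm_by_count P.
have [r1 [t [r2 [Er tX nr1]]]] := has_first hr; have {}tX : t \in X := tX.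
have tr : t \in r by rewrite Er mem_cat inE eqxx orbT.
have ty : t != y.
  move: U; rewrite E => /andP[yr _]; apply: contraNneq yr => <-.
  by rewrite /= !inE tr !orbT.
have tz : t != z.
  move: U; rewrite E => /and5P[_ _ _ _ /andP[zr _]].
  by apply: contraNneq zr => <-.
(* For [w = t] the edge would bypass the triangle on [t], [h1], [h2]; for any other [w] the arc from
   [w] to [t] contains the segment of [v]. *)
have far_t w : w \in X -> w != y -> w != z -> next c w != prev c t /\ ~~ G (next c w) (prev c t).
  move=> wX wy wz; have [->|wt] := eqVneq w t.
    split; first by apply: (good_size gc E) => //; case: gc => _ _; apply.
    apply/negP=> e; apply: (no_bypassed_triangle gc P e12 tX e).
      by rewrite adj_sym a1.
    by rewrite adj_sym a2.
  have wr2 : w \in r2.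
    case: (gc) => _ _ /(_ w wX); rewrite {1}E Er inE mem_cat [w \in z :: _]inE mem_cat [w \in t :: _]inE.
    rewrite (negbTE wy) (negbTE wz) (negbTE wt) /=.
    case/or3P=> // [/IX|wr]; first by rewrite wX.
    by case/hasP: nr1; exists w.
  case/splitPr: wr2 Er => l1 l2 Er.
  apply: (@long_arc_ends c (size ([:: y; u1; v; u3; z] ++ r1 ++ t :: l1)) w
           (l2 ++ [:: y; u1; v; u3; z] ++ r1) t l1) => //.
    have -> : c = ([:: y; u1; v; u3; z] ++ r1 ++ t :: l1) ++ w :: l2.
      by rewrite E Er; do 4!rewrite /= -?catA.
    by rewrite rot_size_cat; do 4!rewrite /= -?catA.
  by rewrite !size_cat /=; nat_lia.
pose A := [set next c w | w in X :\ y :\ z].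
have AE a : a \in A -> exists w, [/\ w \in X, w != y, w != z & a = next c w].
  by case/imsetP=> w; rewrite !inE => /and3P[wz wy wX] ->; exists w.
have [f1 f2] := far_prev gc E yX zX IX isT tX ty.
have [f3 f4] := far_prev gc E yX zX IX isT zX (neq_sym yz).
have fn w := @far_next c y _ z r w gc E yX zX IX isT.
have IA : independent G A.
  by apply: next_set_indep gc _; apply: subset_trans (subD1set _ _) (subD1set _ _).
have I1 : independent G (prev c t |: A).
  apply: independentU1 => // a /AE[w [wX wy wz ->]].
  by rewrite adj_sym; case: (far_t w).
have I2 : independent G (prev c z |: (prev c t |: A)).
  apply: independentU1 => // a; rewrite inE => /orP[|/AE[w [wX wy wz ->]]].
    by rewrite inE => /eqP->; exact: prev_indep.
  by rewrite adj_sym; case: (fn w).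
have I3 : independent G (next c y |: (prev c z |: (prev c t |: A))).
  apply: independentU1 => // a; rewrite !inE => /or3P[/eqP->//|/eqP->//|/AE[w [wX wy wz ->]]].
  exact: next_indep.
have m1 : prev c t \notin A.
  by apply/negP=> /AE[w [wX wy wz /esym/eqP]]; case: (far_t w) => // /negbTE->.
have m2 : prev c z \notin prev c t |: A.
  rewrite !inE negb_or (can_eq (next_prev U)) eq_sym tz /=.
  by apply/negP=> /AE[w [wX wy wz /esym/eqP]]; case: (fn w) => // /negbTE->.
have m3 : next c y \notin prev c z |: (prev c t |: A).
  rewrite !inE !negb_or f1 f3 /=.
  by apply/negP=> /AE[w [wX wy wz /(can_inj (prev_next U))/eqP]]; rewrite eq_sym (negbTE wy).
(* Three vertices and the [#|X| - 2] elements of [A] make [#|X|.+1], too many for [indep_off_X]. *)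
suff : #|next c y |: (prev c z |: (prev c t |: A))| <= #|X|.
  rewrite !cardsU1 m1 m2 m3 (card_next_set _ gc).
  rewrite (cardsD1 y X) yX (cardsD1 z (X :\ y)) !inE eq_sym yz zX /=; nat_lia.
apply: (indep_off_X gc I3) => a; rewrite !inE.
case/or4P=> [/eqP->|/eqP->|/eqP->|/AE[w [wX _ _ ->]]];
  by rewrite ?next_in ?prev_in ?next_notin_X ?prev_notin_X.
Qed.

End Rewiring.

(** * Independence number of vertex sets, connectivity *)

Section IndependenceInSet.

Variables (V : finType) (G : sgraph V).
Implicit Types (A B S O W K : {set V}).

Definition alpha_in A := \max_(S : {set V} | independent G S && (S \subset A)) #|S|.

Lemma alpha_in_ge S A : independent G S -> S \subset A -> #|S| <= alpha_in A.
Proof. by move=> I sub; rewrite /alpha_in (bigD1 S) ?I //= leq_maxl. Qed.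

Lemma independent0 : independent G set0.
Proof. by apply/independentP=> x y; rewrite inE. Qed.

Lemma alpha_in_witness A : exists S, [/\ independent G S, S \subset A & #|S| = alpha_in A].
Proof.
have [|S /andP[I sub] E] :=
    @eq_bigmax_cond _ [pred S : {set V} | independent G S && (S \subset A)] (fun S => #|S|).
  by apply/card_gt0P; exists set0; rewrite !inE independent0 sub0set.
by exists S; split=> //; rewrite /alpha_in -E; apply: eq_bigl.
Qed.

Lemma alpha_in_sub A B : A \subset B -> alpha_in A <= alpha_in B.
Proof.
move=> AB; have [S [I sub <-]] := alpha_in_witness A.
by apply: alpha_in_ge => //; exact: subset_trans AB.
Qed.

Lemma independent_sub S S' : S' \subset S -> independent G S -> independent G S'.
Proof.
by move=> /subsetP sub /independentP I; apply/independentP=> x y /sub xS /sub; exact: I.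
Qed.

Lemma alpha_inU A B : alpha_in (A :|: B) <= alpha_in A + alpha_in B.
Proof.
have [S [I sub <-]] := alpha_in_witness (A :|: B).
rewrite -(cardsID A S); apply: leq_add; apply: alpha_in_ge.
- exact: independent_sub (subsetIl _ _) I.
- exact: subsetIr.
- exact: independent_sub (subsetDl _ _) I.
- by rewrite subDset.
Qed.

Lemma alpha_inU_sep A B : [disjoint A & B] -> {in A & B, forall x y, ~~ G x y} ->
  alpha_in (A :|: B) = alpha_in A + alpha_in B.
Proof.
move=> D N; apply/eqP; rewrite eqn_leq alpha_inU /=.
have [S [I sub <-]] := alpha_in_witness A; have [S' [I' sub' <-]] := alpha_in_witness B.
have DS : [disjoint S & S'] by apply: disjointWl sub _; apply: disjointWr sub' _.
have <- : #|S :|: S'| = #|S| + #|S'|.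
  by rewrite cardsU (disjoint_setI0 DS) cards0 subn0.
apply: alpha_in_ge; last exact: setUSS.
apply/independentP=> x y; rewrite !inE.
move/independentP: I => I; move/independentP: I' => I'.
move/subsetP: sub => sub; move/subsetP: sub' => sub'.
case/orP=> xS; case/orP=> yS; [exact: I| | |exact: I'].
  by apply: N; [exact: sub|exact: sub'].
by rewrite adj_sym; apply: N; [exact: sub|exact: sub'].
Qed.

Lemma alpha_in_gt0 A x : x \in A -> 0 < alpha_in A.
Proof.
move=> xA; rewrite -(cards1 x); apply: alpha_in_ge; last by rewrite sub1set.
by apply/independentP=> y z; rewrite !inE => /eqP-> /eqP->; rewrite adj_irrefl.
Qed.

(** There is a path from [u] to [v] whose inner vertices, if any, lie in [O]. *)
Definition linked O u v := G u v ||
  [exists a in O, exists b in O, [&& G u a, connect (induced G O) a b & G b v]].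

Lemma connect_walk O a b : a \in O -> connect (induced G O) a b ->
  exists p, [/\ walk G p a b, uniq p & {subset p <= O}].
Proof.
move=> aO /connectP[p pp ->]; case: (shortenP pp) => p' pp' U _.
exists (a :: p'); split=> //.
  by rewrite /= !eqxx; apply: sub_path pp' => x y /and3P[].
elim: p' a aO pp' {U p pp} => [|x p IH] a aO /=; first by move=> _ y; rewrite !inE => /eqP->.
case/andP=> /and3P[_ xO _] pp y; rewrite inE => /predU1P[->//|].
exact: IH.
Qed.

Lemma linked_path O u v : linked O u v ->
  exists p, [/\ path G u (rcons p v), uniq p & {subset p <= O}].
Proof.
case/orP=> [e|/exists_inP[a aO /exists_inP[b bO /and3P[e1 /(connect_walk aO)[p [w U sub]] e2]]]].
  by exists [::]; rewrite /= e.
exists p; split=> //; case: p w {U sub} => //= x p /and3P[/eqP-> /eqP lb pp].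
by rewrite e1 rcons_path pp lb e2.
Qed.

(** The gains from adding [S] and [W] to [O] add up. Let [K] be [W] with everything reachable from
    it in [O]; no edge joins [K] to the rest [L], so the independence number of each of the four
    sets splits along [K] and [L]. *)
Lemma alpha_in_unlinked O S W : [disjoint O & S] -> [disjoint W & S] ->
  {in W & S, forall w s, ~~ linked O w s} ->
  alpha_in (O :|: S :|: W) + alpha_in O = alpha_in (O :|: S) + alpha_in (O :|: W).
Proof.
move=> OS WS N.
pose K := W :|: [set o in O | [exists w in W, exists a in O, G w a && connect (induced G O) a o]].
pose L := (O :|: S) :\: K.
have KS x : x \in K -> x \in S -> False.
  rewrite !inE => /orP[xW|/andP[xO _]] xS; first by move/pred0P/(_ x): WS; rewrite /= xW xS.
  by move/pred0P/(_ x): OS; rewrite /= xO xS.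
have KO x : x \in K -> x \in O :|: W by rewrite !inE => /orP[->|/andP[->]] //; rewrite orbT.
have KL : {in K & L, forall x y, ~~ G x y}.
  move=> x y xK; case/setDP=> yOS yK; apply/negP=> e.
  move: xK; rewrite !inE => /orP[xW|/andP[xO /exists_inP[w wW /exists_inP[a aO /andP[e1 co]]]]].
    move: yOS; rewrite inE => /orP[yO|yS].
      case/negP: yK; rewrite !inE yO; apply/orP; right; apply/exists_inP; exists x => //.
      by apply/exists_inP; exists y; rewrite // e connect0.
    by move/negP: (N _ _ xW yS); apply; rewrite /linked e.
  move: yOS; rewrite inE => /orP[yO|yS].
    case/negP: yK; rewrite !inE yO; apply/orP; right; apply/exists_inP; exists w => //.
    apply/exists_inP; exists a; rewrite // e1 /=; apply: connect_trans co (connect1 _).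
    by rewrite /induced /= xO yO.
  move/negP: (N _ _ wW yS); apply; apply/orP; right.
  by apply/exists_inP; exists a => //; apply/exists_inP; exists x; rewrite // e1 co.
have sp A B : A \subset K -> B \subset L -> alpha_in (A :|: B) = alpha_in A + alpha_in B.
  move=> /subsetP AK /subsetP BL; apply: alpha_inU_sep.
    apply/pred0P=> x /=; apply/negbTE/negP=> /andP[/AK xK /BL /setDP[_]].
    by rewrite xK.
  by move=> x y /AK xK /BL; exact: KL.
have OK : O :\: K \subset L by apply: setSD; exact: subsetUl.
have -> : O :|: S :|: W = K :|: L.
  apply/setP=> x; rewrite [in RHS]inE [x \in L]inE.
  have [xK|xK] := boolP (x \in K); first by move: (KO _ xK); rewrite !inE => /orP[]->; rewrite ?orbT.
  rewrite /= !inE; suff /negbTE-> : x \notin W by rewrite orbF.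
  by apply: contra xK; rewrite !inE => ->.
have -> : O :|: W = K :|: (O :\: K).
  apply/setP=> x; rewrite [in RHS]inE [x \in O :\: K]inE.
  have [xK|xK] := boolP (x \in K); first by rewrite (KO _ xK).
  rewrite /= inE; suff /negbTE-> : x \notin W by rewrite orbF.
  by apply: contra xK; rewrite !inE => ->.
have -> : O :|: S = (O :&: K) :|: L.
  apply/setP=> x; rewrite [in RHS]inE [x \in L]inE [x \in O :&: K]inE.
  have [xK|xK] /= := boolP (x \in K); last by rewrite andbF.
  rewrite andbT orbF inE; case xS: (x \in S); last by rewrite orbF.
  by case: (KS x xK xS).
have EO : alpha_in O = alpha_in (O :&: K) + alpha_in (O :\: K).
  by rewrite -sp ?setID //; exact: subsetIr.
rewrite EO (sp K L) // (sp (O :&: K) L) ?subsetIr // (sp K (O :\: K)) //. nat_lia.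
Qed.

End IndependenceInSet.

(** * Separating sets, degrees and cycles *)

Section Connectivity.

Variables (V : finType) (G : sgraph V) (k : nat).
Hypothesis Gk : k_connected G k.

(** A path from [f] that avoids [X] never leaves [F], so [X] separates [f] from [v]. *)
Lemma boundary_card (F X : {set V}) f v : f \in F -> f \notin X -> v \notin F -> v \notin X ->
  (forall x y, x \in F -> x \notin X -> G x y -> y \notin X -> y \in F) -> k <= #|X|.
Proof.
move=> fF fX vF vX cl; rewrite leqNgt; apply/negP=> lt.
case/andP: Gk => _ /forallP/(_ X); rewrite lt /= => /andP[_ /forall_inP/(_ f)].
rewrite inE fX => /(_ isT)/forall_inP/(_ v); rewrite inE vX => /(_ isT)/connectP[p pp lp].
move: vF; rewrite lp; case/negP.
elim: p f fF fX pp {lp} => [//|x p IH] f fF fX /= /andP[/and3P[_ xX e] pp].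
rewrite inE in xX; exact: IH (cl _ _ fF fX e xX) xX pp.
Qed.

(** The neighbourhood separates [x] from any non-neighbour; without one the degree is [#|V|.-1]. *)
Lemma degree_ge x : k <= degree G x.
Proof.
have [d|d] := ltnP (degree G x).+1 #|V|; last first.
  by case/andP: Gk; lia.
have [v vN] : exists v, v \notin x |: [set y | G x y].
  apply/existsP; rewrite -negb_forall; apply/negP=> /forallP H.
  have : #|V| <= #|x |: [set y | G x y]|.
    by apply/subset_leq_card/subsetP=> y _; exact: H.
  by move: d; rewrite cardsU1 /degree; case: (x \notin _) => /=; nat_lia.
move: vN; rewrite !inE negb_or => /andP[vx xv].
apply: (@boundary_card [set x] [set y | G x y] x v); rewrite ?inE ?eqxx ?adj_irrefl //.
by move=> y z; rewrite !inE => /eqP-> _ e; rewrite e.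
Qed.

(** Two neighbours of [x] are joined by a path avoiding [x], which [x] closes. *)
Lemma exists_cyc : 1 < k -> exists c, cyc G c.
Proof.
move=> k2.
have [x _] : exists x, x \in V by apply/existsP; rewrite -[[exists _, _]]negbK negb_exists;
  apply/negP=> /forallP H; case/andP: Gk => + _; rewrite (eq_card0 (A := V)) // => y;
  apply/negbTE/H.
have : 1 < #|[set y | G x y]| by apply: leq_trans k2 (degree_ge x).
case/card_gt1P=> y [z []]; rewrite !inE => xy xz yz.
have : connected_on G (~: [set x]).
  by case/andP: Gk => _ /forallP/(_ [set x]); rewrite cards1 k2.
have neq w : G x w -> w \in ~: [set x] by rewrite !inE; apply: contraTneq => ->; rewrite adj_irrefl.
case/andP=> _ /forall_inP/(_ y (neq _ xy))/forall_inP/(_ z (neq _ xz)).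
case/(connect_walk (neq _ xy)) => p [w U sub].
exists (x :: p); apply/and3P; split.
- by case: p w {U sub} => [|a [|b p]] //= /and3P[/eqP-> /eqP yz']; rewrite yz' eqxx in yz.
- by apply: walk_cycle (walk_cons w xy) _; rewrite adj_sym.
- by rewrite /= U andbT; apply/negP=> /sub; rewrite !inE eqxx.
Qed.

End Connectivity.

(** * A cycle whose complement is a clique *)

Lemma lex_lt_fst a a' m m' n : a' < a -> m' <= n -> a * n.+1 + m <= a' * n.+1 + m' -> False.
Proof. nia. Qed.

Lemma lex_lt_snd a a' m m' n : a' <= a -> m' < m -> a * n.+1 + m <= a' * n.+1 + m' -> False.
Proof. nia. Qed.

Section Kouider.

Variables (V : finType) (G : sgraph V) (k : nat).
Hypothesis Gk : k_connected G k.
Hypothesis k2 : 1 < k.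
Hypothesis no_ham : forall c, cyc G c -> exists v, v \notin c.

Local Notation alpha_in := (alpha_in G).

(** The set [F] is a nonempty union of components of the graph minus [c]; minimality will make it a
    single one. *)
Definition cut_off c (F : {set V}) :=
  [/\ cyc G c, F != set0, {in F, forall x, x \notin c} &
      forall x y, x \in F -> y \notin c -> G x y -> y \in F].

(** The lexicographic order on two numbers, encoded in one: [#|F|] stays below the factor
    [#|V|.+1]. *)
Definition cut_off_weight (c : seq V) (F : {set V}) := alpha_in (~: [set x in c]) * #|V|.+1 + #|F|.

Section Minimal.

Variables (c : seq V) (F : {set V}).
Hypothesis cF : cut_off c F.
Hypothesis cF_min : forall c' F', cut_off c' F' -> cut_off_weight c F <= cut_off_weight c' F'.

Let O := ~: ([set x in c] :|: F).
Let X := [set x in c | [exists f in F, G f x]].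

Let c_cyc : cyc G c. Proof. by case: cF. Qed.
Let c_uniq : uniq c. Proof. by case/and3P: c_cyc. Qed.
Let F_c x : x \in F -> x \notin c. Proof. by case: cF => _ _ + _; apply. Qed.

Let X_c : {subset X <= c}. Proof. by move=> x; rewrite inE => /andP[]. Qed.

Let OE x : (x \in O) = (x \notin c) && (x \notin F).
Proof. by rewrite !inE negb_or. Qed.

Let F_nbr x y : x \in F -> G x y -> (y \in X) || (y \in F).
Proof.
move=> xF e; have [yc|yc] := boolP (y \in c).
  by apply/orP; left; rewrite inE yc; apply/exists_inP; exists x.
by case: cF => _ _ _ /(_ _ _ xF yc e)->; rewrite orbT.
Qed.

Let alpha_cO : alpha_in (~: [set x in c]) = alpha_in F + alpha_in O.
Proof.
rewrite -alpha_inU_sep; first congr alpha_in.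
- apply/setP=> x; rewrite !inE negb_or; have [xF|xF] := boolP (x \in F); last by rewrite andbT.
  by rewrite F_c.
- by apply/pred0P=> x /=; rewrite OE; case: (x \in F); rewrite ?andbF.
- move=> x y xF; rewrite OE => /andP[yc yF]; apply: contra yF => e.
  by case: cF => _ _ _ /(_ _ _ xF yc e).
Qed.

(** The part of [F] reachable from [f] is itself cut off by [c], so by minimality it is all of
    [F]. *)
Lemma minimal_connected f g : f \in F -> g \in F -> connect (induced G F) f g.
Proof.
move=> fF gF; pose F' := [set x in F | connect (induced G F) f x].
have sF : F' \subset F by apply/subsetP=> x; rewrite inE => /andP[].
have/cF_min : cut_off c F'.
  split=> //; first by apply/set0Pn; exists f; rewrite inE fF connect0.
    by move=> x; rewrite inE => /andP[/F_c].
  move=> x y; rewrite !inE => /andP[xF co] yc e.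
  have yF : y \in F by case: cF => _ _ _ /(_ _ _ xF yc e).
  by rewrite yF; apply: connect_trans co (connect1 _); rewrite /induced /= xF yF.
rewrite /cut_off_weight leq_add2l => le.
have /eqP E : F' == F by rewrite eqEcard sF.
have : g \in F' by rewrite E.
by rewrite inE => /andP[].
Qed.

Lemma walk_through_F y z : y \in X -> z \in X ->
  exists P a b, [/\ walk G P a b, uniq P, {subset P <= F}, G y a & G b z].
Proof.
rewrite !inE => /andP[_ /exists_inP[f fF fy]] /andP[_ /exists_inP[g gF gz]].
have [P [w U sub]] := connect_walk fF (minimal_connected fF gF).
by exists P, f, g; rewrite adj_sym.
Qed.

(** Either [c'] swallows [F] and the independence number of the complement drops, or the rest of [F]
    is a smaller set cut off by [c'], because [c'] retains [X]. Both contradict minimality. *)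
Lemma no_reroute c' f : cyc G c' -> {subset X <= c'} -> f \in F -> f \in c' ->
  alpha_in (~: [set x in c'] :\: F) <= alpha_in O -> False.
Proof.
move=> cyc' Xc' fF fc' le.
pose F' := F :\: [set x in c'].
have le1 : alpha_in (~: [set x in c']) <= alpha_in F' + alpha_in (~: [set x in c'] :\: F).
  apply: leq_trans (alpha_inU _ _ _); apply: alpha_in_sub; apply/subsetP=> x; rewrite !inE => ->.
  by case: (x \in F).
have [F0|F0] := eqVneq F' set0.
  have alF' : alpha_in F' = 0.
    have [S [_ + <-]] := alpha_in_witness G F'; rewrite F0 subset0 => /eqP->.
    by rewrite cards0.
  have /cF_min : cut_off c' (~: [set x in c']).
    split=> //; last by move=> x y _; rewrite !inE.
      by have [v vc] := no_ham cyc'; apply/set0Pn; exists v; rewrite !inE.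
    by move=> x; rewrite !inE.
  apply: lex_lt_fst; last exact: max_card.
  by rewrite alpha_cO; have := alpha_in_gt0 G fF; nat_lia.
have /cF_min : cut_off c' F'.
  split=> //; first by move=> x; rewrite !inE => /andP[].
  move=> x y; rewrite !inE => /andP[_ xF] yc e; rewrite yc /=.
  by case/orP: (F_nbr xF e) => // /Xc'; rewrite (negbTE yc).
have ltF : #|F'| < #|F|.
  apply: proper_card; rewrite properE subsetDl /=; apply/subsetPn; exists f => //.
  by rewrite !inE fc'.
apply: lex_lt_snd ltF; rewrite alpha_cO.
by have := alpha_in_sub G (subsetDl F [set x in c'] : F' \subset F); nat_lia.
Qed.

(** Such a piece of [c] can be released into [O] at no cost in the first component of the weight. *)
Let free (L : seq V) := alpha_in (O :|: [set x in L]) <= alpha_in O.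

Let after_cycle y : y \in c -> [/\ cycle G (y :: after c y), uniq (y :: after c y) &
  y :: after c y =i c].
Proof.
move=> yc; rewrite -(rot_after yc) rot_cycle rot_uniq; case/and3P: c_cyc => _ -> ->.
by split=> // x; rewrite mem_rot.
Qed.

Let uniq_reroute (B P p : seq V) : uniq B -> {subset B <= c} -> uniq P -> {subset P <= F} ->
  uniq p -> {subset p <= O} -> uniq (B ++ P ++ p).
Proof.
move=> UB Bc UP PF Up pO; rewrite !cat_uniq UB UP Up andbT /=.
apply/andP; split; apply/hasPn=> x.
  rewrite mem_cat => /orP[/PF/F_c|/pO]; last rewrite OE => /andP[+ _];
  by apply: contra => /Bc.
by move/pO; rewrite OE => /andP[_]; apply: contra => /PF.
Qed.

(** If [L] were free, a walk through [F] could replace it in [c], against [no_reroute]. *)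
Lemma segment_not_free y z L r : y \in X -> z \in X -> after c y = L ++ z :: r ->
  {in L, forall v, v \notin X} -> ~~ free L.
Proof.
move=> yX zX E LX; apply/negP=> fr.
have [C U M] := after_cycle (X_c yX); rewrite E in C U M.
have [P [a [b [w UP sub ea eb]]]] := walk_through_F yX zX.
have [a' [b' [w' e']]] := cycle_walk C isT.
have [p [q [w1 w2 _]]] := @walk_catE _ _ (y :: L) (z :: r) _ _ w' isT isT.
have ? := walk_headE w1; have ? := walk_headE w2; subst a' q.
have sB : {subset y :: z :: r <= c}.
  by move=> x; rewrite -M !inE mem_cat !inE => /or3P[]->; rewrite ?orbT.
have UB : uniq (y :: z :: r).
  apply: subseq_uniq U; rewrite -cat1s -[y :: L ++ _]cat1s.
  by apply: cat_subseq => //; exact: suffix_subseq.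
apply: (@no_reroute ([:: y] ++ P ++ (z :: r)) a).
- apply/and3P; split.
  + by case: (P) w => //= ? ? _; rewrite size_cat /=; nat_lia.
  + apply: walk_cycle e'; apply: walk_cat (walk1 _ _) _ ea; exact: walk_cat w w2 eb.
  + rewrite (_ : uniq _ = uniq ((y :: z :: r) ++ P ++ [::])).
      by apply: uniq_reroute => //.
    by apply/perm_uniq; rewrite /= perm_cons cats0 -cat_cons perm_catC.
- move=> x xX; have := X_c xX; rewrite -M !(inE, mem_cat).
  case/orP=> [->//|/orP[/LX|->]]; first by rewrite xX.
  by rewrite !orbT.
- exact: sub (walk_head w).
- by rewrite !mem_cat (walk_head w) orbT.
- apply: leq_trans fr; apply: alpha_in_sub; apply/subsetP=> x; rewrite !(inE, mem_cat) !negb_or.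
  move=> /and3P[xF xy /and3P[_ xz xr]]; rewrite xF andbT.
  have [xc|//] := boolP (x \in c); apply/orP; right.
  by move: xc; rewrite -M !(inE, mem_cat) (negbTE xy) (negbTE xz) (negbTE xr) !orbF.
Qed.

Let free_nil : free [::].
Proof. by rewrite /free; apply: alpha_in_sub; apply/subsetP=> x; rewrite !inE orbF. Qed.

Let first_X y y' : y \in X -> y' \in X -> y != y' -> exists L z r,
  [/\ after c y = L ++ z :: r, z \in X & {in L, forall v, v \notin X}].
Proof.
move=> yX y'X yy'; have [_ _ M] := after_cycle (X_c yX).
have /has_first[L [z [r [E zX n]]]] : has (mem X) (after c y).
  apply/hasP; exists y' => //; have := X_c y'X; rewrite -M inE eq_sym (negbTE yy').
  by [].
exists L, z, r; split=> // v vL; apply: contra n => vX; by apply/hasP; exists v.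
Qed.

(** Once [c] has a vertex off [X], the set [X] separates it from [F]. Such a vertex exists since
    segments between consecutive vertices of [X] are not free, hence not empty, and since [c] has at
    least three vertices if [#|X|] is at most one. *)
Lemma card_X_ge : k <= #|X|.
Proof.
have [f fF] : exists f, f \in F by case: cF => _ /set0Pn.
have [v [vc vX]] : exists v, v \in c /\ v \notin X.
  have [X2|X2] := ltnP 1 #|X|.
    case/card_gt1P: X2 => y [y' [yX y'X yy']].
    have [L [z [r [E zX LX]]]] := first_X yX y'X yy'.
    have := segment_not_free yX zX E LX.
    case: L E LX => [|v L] E LX; first by rewrite free_nil.
    have [_ _ M] := after_cycle (X_c yX) => _; exists v; split; last by rewrite LX ?inE ?eqxx.
    by rewrite -M E !inE eqxx orbT.
  have : ~~ ([set x in c] \subset X).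
    apply/negP=> /subset_leq_card; rewrite cardsE (card_uniqP c_uniq).
    by case/and3P: c_cyc => sz _ _; nat_lia.
  by case/subsetPn=> v; rewrite inE => vc vX; exists v.
apply: (boundary_card Gk fF _ _ vX).
- by apply/negP=> /X_c; rewrite (negbTE (F_c fF)).
- by apply/negP=> /F_c; rewrite vc.
- by move=> x y xF _ e yX; case/orP: (F_nbr xF e) => //; rewrite (negbTE yX).
Qed.

(** The search over lengths makes [W y] the shortest piece after [y] that is not free; it stops
    before the next vertex of [X] by [segment_not_free]. *)
Let d y := find (fun j => ~~ free (take j (after c y))) (iota 0 (size c)).
Let W y := take (d y) (after c y).

Let W_spec y : y \in X -> [/\ {in W y, forall v, v \notin X}, ~~ free (W y),
  d y <= size (after c y) & forall j, j < d y -> free (take j (after c y))].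
Proof.
move=> yX.
have [y' y'X yy'] : exists2 y', y' \in X & y != y'.
  have [y' /setD1P[t't t'X]] : exists x, x \in X :\ y.
    apply/set0Pn; rewrite -card_gt0; have := card_X_ge; move: k2.
    by rewrite (cardsD1 y) yX; nat_lia.
  by exists y'; rewrite // eq_sym.
have [L [z [r [E zX LX]]]] := first_X yX y'X yy'.
have nf := segment_not_free yX zX E LX.
have szc : size (after c y) < size c.
  by rewrite -[ltnRHS](size_rot (index y c)) (rot_after (X_c yX)).
have szL : size L < size c by apply: leq_ltn_trans szc; rewrite E size_cat; nat_lia.
have bf j : j < d y -> free (take j (after c y)).
  move=> jd; have := before_find 0 jd; rewrite nth_iota; first by move/negbFE.
  by apply: leq_trans jd _; rewrite -[leqRHS](size_iota 0); exact: find_size.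
have dL : d y <= size L.
  rewrite leqNgt; apply/negP=> /bf; rewrite E take_size_cat //.
  by apply/negP.
have has_nf : has (fun j => ~~ free (take j (after c y))) (iota 0 (size c)).
  by apply/hasP; exists (size L); rewrite ?mem_iota // E take_size_cat.
split=> //.
- move=> v; rewrite /W E takel_cat // => /mem_take; exact: LX.
- by have := nth_find 0 has_nf; rewrite nth_iota //; exact: leq_ltn_trans dL szL.
- by rewrite E size_cat; nat_lia.
Qed.

Let W_c y v : y \in X -> v \in W y -> v \in c.
Proof.
move=> yX /mem_take vy; have [_ _ <-] := after_cycle (X_c yX).
by rewrite inE vy orbT.
Qed.

Let W_prefix y z L1 L2 : y \in X -> z \in X -> after c y = L1 ++ z :: L2 ->
  exists T, L1 = W y ++ T.
Proof.
move=> yX zX E; have [WX _ dy _] := W_spec yX.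
exists (drop (d y) L1); rewrite /W E takel_cat ?cat_take_drop //.
rewrite leqNgt; apply/negP=> lt.
have : z \in W y.
  rewrite /W E take_cat ltnNge (ltnW lt) /= mem_cat -[d y - _]prednK ?subn_gt0 //=.
  by rewrite inE eqxx orbT.
by move/WX; rewrite zX.
Qed.

Let W_prefix_free y S u R : y \in X -> W y = S ++ u :: R -> free S.
Proof.
move=> yX E; have [_ _ dy bf] := W_spec yX.
have szW : size (W y) = d y by rewrite size_takel.
have lt : size S < d y by rewrite -szW E size_cat /=; nat_lia.
have -> : S = take (size S) (after c y); last exact: bf.
by rewrite -(cat_take_drop (d y) (after c y)) -/(W y) E -catA take_size_cat.
Qed.

Let O_c v : v \in O -> v \in c -> False.
Proof. by rewrite OE => /andP[/negbTE->]. Qed.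

(* Consider a linked pair as close as possible to [y] and [z]: the initial
   pieces before it are unlinked and free, so [c] can be rerouted through [F]
   and the link while dropping only these two pieces. *)
Lemma unlinked y z : y \in X -> z \in X -> y != z -> {in W y & W z, forall u v, ~~ linked G O u v}.
Proof.
move=> yX zX yz.
(* Minimality of the linked pair becomes induction on the number of vertices before its ends: [S1]
   and [S2] may be taken as unlinked. *)
suff main n S1 u R1 S2 v R2 : size S1 + size S2 < n -> W y = S1 ++ u :: R1 ->
    W z = S2 ++ v :: R2 -> ~~ linked G O u v.
  move=> u v /mem_split[S1 [R1 E1]] /mem_split[S2 [R2 E2]].
  exact: main (ltnSn _) E1 E2.
elim: n S1 u R1 S2 v R2 => [//|n IH] S1 u R1 S2 v R2 sz E1 E2.
have [L1 [L2 [EL1 EL2]]] := after_split c_uniq (X_c yX) (X_c zX) yz.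
have [T1 ET1] := W_prefix yX zX EL1; have [T2 ET2] := W_prefix zX yX EL2.
have [C U M] := after_cycle (X_c yX).
have EB : y :: after c y = (y :: S1) ++ (u :: R1 ++ T1) ++ (z :: S2) ++ (v :: R2 ++ T2).
  by rewrite EL1 ET1 ET2 E1 E2; do 4!rewrite /= -?catA.
rewrite EB in C U M.
have S1c x : x \in S1 -> x \in c by move=> xS; rewrite -M !(inE, mem_cat) xS !orbT.
have S2c x : x \in S2 -> x \in c by move=> xS; rewrite -M !(inE, mem_cat) xS !orbT.
have S12 x : x \in S1 -> x \in S2 -> False.
  move=> x1 x2; move: U; rewrite cat_uniq => /and3P[_ /hasPn/(_ x) + _].
  by rewrite !(inE, mem_cat) x1 x2 !orbT => /(_ isT).
have drop_free : alpha_in (O :|: [set x in S2] :|: [set x in S1]) <= alpha_in O.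
  have f1 := W_prefix_free yX E1; have f2 := W_prefix_free zX E2; rewrite /free in f1 f2.
  have D1 : [disjoint O & [set x in S2]].
    by apply/pred0P=> x /=; apply/negbTE/negP=> /andP[xO]; rewrite inE => /S2c; exact: O_c xO.
  have D2 : [disjoint [set x in S1] & [set x in S2]].
    by apply/pred0P=> x /=; apply/negbTE/negP; rewrite !inE => /andP[]; exact: S12.
  have D3 : {in [set x in S1] & [set x in S2], forall u' v', ~~ linked G O u' v'}.
    move=> u' v'; rewrite !inE => /mem_split[A1 [B1 F1]] /mem_split[A2 [B2 F2]].
    apply: (IH A1 _ (B1 ++ u :: R1) A2 _ (B2 ++ v :: R2)).
    + by move: sz; rewrite F1 F2 !size_cat /=; nat_lia.
    + by rewrite E1 F1 -catA.
    + by rewrite E2 F2 -catA.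
  by have := alpha_in_unlinked D1 D2 D3; nat_lia.
apply/negP=> /linked_path[p [pp Up pO]].
have [P [a [b [w UP PF ea eb]]]] := walk_through_F yX zX.
have [a' [b' [w' e']]] := cycle_walk C isT.
have [? [u' [w1 w2 _]]] := walk_catE w' isT isT.
have [q [z' [w3 w4 eq]]] := walk_catE w2 isT isT.
have [? [v' [_ w5 _]]] := walk_catE w4 isT isT.
have ? := walk_headE w1; have ? := walk_headE w3; have ? := walk_headE w4.
have ? := walk_headE w5; subst a' u' z' v'.
have [p0 [w6 e6]] := path_walk pp w5.
set RR1 := u :: R1 ++ T1; set RR2 := v :: R2 ++ T2.
have UB : uniq ((y :: RR1) ++ (z :: RR2)).
  apply: subseq_uniq U; rewrite catA; apply: cat_subseq.
    by rewrite /= eqxx; exact: suffix_subseq.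
  by rewrite cat_cons -cat1s -[z :: S2 ++ _]cat1s; apply: cat_subseq => //; exact: suffix_subseq.
have Bc : {subset (y :: RR1) ++ (z :: RR2) <= c}.
  move=> x; rewrite -M mem_cat !inE => /orP[]/orP[]; rewrite !(inE, mem_cat) => ->; by rewrite ?orbT.
(* The new cycle goes from [y] through [F] to [z], backwards to [u], over the link [p] to [v], and
   on to [y]; on [c] only [S1] and [S2] are lost. *)
apply: (@no_reroute ([:: y] ++ P ++ [:: z] ++ rev RR1 ++ p ++ RR2) a).
- apply/and3P; split.
  + by case: (P) w => //= ? ? _; rewrite !size_cat /=; nat_lia.
  + apply: walk_cycle e'; apply: walk_cat (walk1 _ _) _ ea; apply: walk_cat w _ eb.
    apply: (walk_cat (walk1 _ _)); last by rewrite adj_sym; exact: eq.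
    exact: walk_cat (walk_rev w3) w6 e6.
  + have -> : uniq ([:: y] ++ P ++ [:: z] ++ rev RR1 ++ p ++ RR2) =
              uniq (((y :: RR1) ++ (z :: RR2)) ++ P ++ p).
      apply/perm_uniq/permP=> f; rewrite !(count_cat, count_rev) /= !(count_cat, count_rev) /=; clear; lia.
    exact: uniq_reroute.
- move=> x xX; have := X_c xX; rewrite -M.
  have nS1 : x \notin S1.
    have [WX _ _ _] := W_spec yX.
    by apply/negP=> xS; have := WX x; rewrite E1 mem_cat xS xX => /(_ isT).
  have nS2 : x \notin S2.
    have [WX _ _ _] := W_spec zX.
    by apply/negP=> xS; have := WX x; rewrite E2 mem_cat xS xX => /(_ isT).
  rewrite !mem_cat mem_rev ![x \in _ :: S1]inE ![x \in _ :: S2]inE (negbTE nS1) (negbTE nS2) !orbF.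
  rewrite !inE; case/or4P=> ->; by rewrite ?orbT.
- exact: PF (walk_head w).
- by rewrite !mem_cat (walk_head w) orbT.
- apply: leq_trans drop_free; apply: alpha_in_sub; apply/subsetP=> x /setDP[xc' xF].
  rewrite in_setC in_set in xc'.
  have xR1 : x \notin RR1 by apply: contra xc' => xR; rewrite !mem_cat mem_rev xR !orbT.
  have xR2 : x \notin RR2 by apply: contra xc' => xR; rewrite !mem_cat xR !orbT.
  have xy : x != y by apply: contra xc' => /eqP->; rewrite mem_cat mem_head.
  have xz : x != z by apply: contra xc' => /eqP->; rewrite !mem_cat mem_head !orbT.
  rewrite 2!in_setU OE xF andbT [x \in [set _ in S2]]inE [x \in [set _ in S1]]inE.
  have [xc|//] := boolP (x \in c).
  have : x \in (y :: S1) ++ RR1 ++ (z :: S2) ++ RR2 by rewrite M.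
  rewrite 3!mem_cat (negbTE xR1) (negbTE xR2) [_ \in _ :: S1]inE [_ \in _ :: S2]inE.
  by rewrite (negbTE xy) (negbTE xz) /= orbF => /orP[]->; rewrite ?orbT.
Qed.

Let WU s := [set x | has (fun y => x \in W y) s].

Let W_disjoint y z x : y \in X -> z \in X -> y != z -> x \in W y -> x \in W z -> False.
Proof.
move=> yX zX yz xy xz.
have [L1 [L2 [EL1 EL2]]] := after_split c_uniq (X_c yX) (X_c zX) yz.
have [T1 ET1] := W_prefix yX zX EL1; have [T2 ET2] := W_prefix zX yX EL2.
have [_ U _] := after_cycle (X_c yX).
move: U; rewrite EL1 cons_uniq cat_uniq => /and3P[_ _ /andP[/hasPn/(_ x) + _]].
by rewrite ET1 ET2 !(inE, mem_cat) xy xz !orbT => /(_ isT).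
Qed.

(** The pieces are added one by one. Each is not free and is unlinked from the earlier ones, so by
    [alpha_in_unlinked] it gains at least one. *)
Let alpha_in_WU s : uniq s -> {subset s <= X} -> alpha_in O + size s <= alpha_in (O :|: WU s).
Proof.
elim: s => [|y s IH] /= U sX; first by rewrite addn0; apply: alpha_in_sub; exact: subsetUl.
case/andP: U => ys Us.
have yX : y \in X by apply: sX; rewrite inE eqxx.
have {}sX : {subset s <= X} by move=> x xs; apply: sX; rewrite inE xs orbT.
have {}IH := IH Us sX.
have -> : O :|: WU (y :: s) = O :|: WU s :|: [set x in W y].
  by rewrite -setUA; congr (_ :|: _); apply/setP=> x; rewrite !inE /= orbC.
have D1 : [disjoint O & WU s].
  apply/pred0P=> x /=; apply/negbTE/negP=> /andP[xO]; rewrite inE => /hasP[z /sX zX /(W_c zX)].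
  exact: O_c xO.
have D2 : [disjoint [set x in W y] & WU s].
  apply/pred0P=> x /=; apply/negbTE/negP; rewrite !inE => /andP[xy /hasP[z zs xz]].
  apply: (W_disjoint yX (sX _ zs) _ xy xz).
  by apply: contraNneq ys => ->.
have D3 : {in [set x in W y] & WU s, forall u v, ~~ linked G O u v}.
  move=> u v; rewrite !inE => uy /hasP[z zs vz].
  apply: (unlinked yX (sX _ zs) _ uy vz).
  by apply: contraNneq ys => ->.
have := alpha_in_unlinked D1 D2 D3.
have [_ + _ _] := W_spec yX; rewrite /free -ltnNge => lt E; rewrite -(leq_add2r (alpha_in O)) E.
by rewrite addnS addSn -addnS; exact: leq_add.
Qed.

(** The pieces [W y] avoid [X], so no edge joins [F] to them or to [O], and the independence numbers
    add up. *)
Lemma alpha_ge : alpha_in F + alpha_in O + #|X| <= alpha_in setT.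
Proof.
have sX : {subset enum X <= X} by move=> x; rewrite mem_enum.
have := alpha_in_WU (enum_uniq X) sX; rewrite -cardE -(leq_add2l (alpha_in F)) addnA => H.
apply: leq_trans H _; rewrite -alpha_inU_sep; first exact: alpha_in_sub (subsetT _).
  apply/pred0P=> x /=; apply/negbTE/negP=> /andP[xF]; rewrite in_setU OE xF andbF inE.
  by case/hasP=> z /sX zX /(W_c zX); rewrite (negbTE (F_c xF)).
move=> x y xF; rewrite in_setU => yOW; apply/negP=> e; case/orP: (F_nbr xF e) => yXF.
  case/orP: yOW => [yO|]; first exact: O_c yO (X_c yXF).
  by rewrite inE => /hasP[z /sX zX]; have [WX _ _ _] := W_spec zX; move/WX; rewrite yXF.
case/orP: yOW => [|]; first by rewrite OE yXF andbF.
by rewrite inE => /hasP[z /sX zX /(W_c zX)]; rewrite (negbTE (F_c yXF)).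
Qed.

End Minimal.

Lemma ex_minimal (T : Type) (P : T -> Prop) (m : T -> nat) :
  (exists x, P x) -> exists x, P x /\ forall y, P y -> m x <= m y.
Proof.
case=> x0 Px0; apply: NNPP => N.
have none n x : m x <= n -> ~ P x.
  elim/ltn_ind: n x => n IH x le Px; apply: N; exists x; split=> // y Py.
  rewrite leqNgt; apply/negP=> lt; exact: (IH (m y) (leq_trans lt le) y (leqnn _) Py).
exact: none (leqnn _) Px0.
Qed.

(** In [alpha_ge] the set [F] contributes at least one and [X] at least [k]. The bound [k.+1] thus
    leaves [O] empty, [F] a clique and [#|X|] equal to [k]. *)
Lemma kouider : (forall S, independent G S -> #|S| <= k.+1) ->
  exists c, [/\ cyc G c, {in [predC c] &, forall x y, x != y -> G x y} &
    #|[set x in c | [exists f, (f \notin c) && G f x]]| = k].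
Proof.
move=> al.
have ex : exists cF, cut_off cF.1 cF.2.
  have [c cc] := exists_cyc Gk k2; exists (c, ~: [set x in c]); split=> //=.
  - by have [v vc] := no_ham cc; apply/set0Pn; exists v; rewrite !inE.
  - by move=> x; rewrite !inE.
  - by move=> x y _ yc _; rewrite !inE.
have [[c F] [/= cF cF_min]] := ex_minimal (fun cF => cut_off_weight cF.1 cF.2) ex.
have {}cF_min c' F' : cut_off c' F' -> cut_off_weight c F <= cut_off_weight c' F'.
  exact: (cF_min (c', F')).
have ge := alpha_ge cF cF_min; have Xk := card_X_ge cF cF_min.
have le : alpha_in setT <= k.+1.
  by have [S [I _ <-]] := alpha_in_witness G setT; exact: al.
have [cc /set0Pn[f fF] Fc _] := cF.
have aF := alpha_in_gt0 G fF.
have FE x : (x \in F) = (x \notin c).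
  apply/idP/idP=> [/Fc//|xc]; apply: contraT => xF.
  have xO : x \in ~: ([set x in c] :|: F) by rewrite !inE negb_or xc.
  have := alpha_in_gt0 G xO; nat_lia.
exists c; split=> //.
  move=> x y; rewrite !inE -!FE => xF yF xy; apply: contraT => n.
  have : #|[set x; y]| <= alpha_in F.
    apply: alpha_in_ge; last by apply/subsetP=> z; rewrite !inE => /orP[] /eqP->.
    by apply/independentP=> a b; rewrite !inE => /orP[] /eqP-> /orP[] /eqP->;
      rewrite ?adj_irrefl // adj_sym.
  rewrite cards2 xy; nat_lia.
suff -> : [set x in c | [exists f, (f \notin c) && G f x]] = [set x in c | [exists f in F, G f x]].
  by apply/eqP; rewrite eqn_leq; nat_lia.
apply/setP=> x; rewrite !inE; congr (_ && _); apply: eq_existsb => g; by rewrite FE.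
Qed.

End Kouider.

(** * Cut vertices and the exceptional graphs *)

Section Exceptional.

Variables (V : finType) (G : sgraph V).

(** Identifies the two cliques of a model graph with two lists of vertices; [x0] is only a default
    for [nth]. *)
Definition layout (x0 : V) (q r : seq V) a b (u : 'I_a + 'I_b) : V :=
  match u with inl i => nth x0 q i | inr j => nth x0 r j end.

Lemma layout_bij x0 (q r : seq V) a b : perm_eq (q ++ r) (enum V) -> size q = a -> size r = b ->
  bijective (@layout x0 q r a b).
Proof.
move=> P sq sr.
have U : uniq (q ++ r) by rewrite (perm_uniq P) enum_uniq.
rewrite cat_uniq in U; case/and3P: U => Uq /hasPn D Ur.
apply: inj_card_bij; last first.
  by rewrite card_sum !card_ord cardE -(perm_size P) size_cat sq sr.
have D' (i : 'I_a) (j : 'I_b) : nth x0 q i = nth x0 r j -> False.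
  move=> E; have /D /= : nth x0 r j \in r by rewrite mem_nth ?sr.
  by rewrite -E mem_nth ?sq.
move=> [i|i] [j|j] /= E.
- have li : i < size q by rewrite sq. have lj : j < size q by rewrite sq.
  by congr inl; apply/val_inj/eqP; rewrite -(nth_uniq x0 li lj Uq) E.
- by case: (D' _ _ E).
- by case: (D' _ _ (esym E)).
- have li : i < size r by rewrite sr. have lj : j < size r by rewrite sr.
  by congr inr; apply/val_inj/eqP; rewrite -(nth_uniq x0 li lj Ur) E.
Qed.

Definition clique (q : seq V) := {in q &, forall x y, x != y -> G x y}.

Lemma clique_nth x0 q a (i j : 'I_a) : clique q -> uniq q -> size q = a ->
  G (nth x0 q i) (nth x0 q j) = (i != j).
Proof.
move=> K U sq; have [->|ij] := eqVneq i j; first by rewrite adj_irrefl.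
by apply: K; rewrite ?mem_nth ?sq // nth_uniq ?sq.
Qed.

Lemma G3_iso q0 q r0 r1 : perm_eq ((q0 :: q) ++ [:: r0; r1]) (enum V) ->
  clique (q0 :: q) -> G r0 r1 ->
  {in q0 :: q & [:: r0; r1], forall x y, G x y = (x == q0) && (y == r0)} ->
  isomorphic (G3 #|V|) G.
Proof.
move=> P Kq e01 E.
have U : uniq ((q0 :: q) ++ [:: r0; r1]) by rewrite (perm_uniq P) enum_uniq.
have sV : #|V| = size q + 3 by rewrite cardE -(perm_size P) size_cat /=; lia.
have sq : size (q0 :: q) = #|V| - 2 by rewrite sV /=; lia.
rewrite cat_uniq in U; case/and3P: U => Uq _ Ur.
have Kr : clique [:: r0; r1].
  by move=> x y; rewrite !inE => /orP[]/eqP-> /orP[]/eqP-> //; rewrite ?eqxx // adj_sym.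
exists (@layout q0 (q0 :: q) [:: r0; r1] (#|V| - 2) 2); first exact: layout_bij.
have cross (i : 'I_(#|V| - 2)) (j : 'I_2) :
    G (nth q0 (q0 :: q) i) (nth q0 [:: r0; r1] j) = (i == 0 :> nat) && (j == 0 :> nat).
  rewrite E ?mem_nth ?sq //; congr (_ && _).
    by rewrite -[X in _ == X]/(nth q0 (q0 :: q) 0) nth_uniq ?sq //; move: (ltn_ord i); lia.
  by rewrite -[X in _ == X]/(nth q0 [:: r0; r1] 0) nth_uniq.
move=> [i|i] [j|j] /=; [exact: clique_nth|exact: cross|by rewrite adj_sym; exact: cross|].
exact: clique_nth.
Qed.

Lemma G1_embeds q0 q1 q r0 r1 : perm_eq ([:: q0, q1 & q] ++ [:: r0; r1]) (enum V) ->
  clique [:: q0, q1 & q] -> G r0 r1 -> G q0 r0 -> G q1 r0 -> spanning_embeds (G1 #|V|) G.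
Proof.
move=> P Kq e01 e0 e1.
have U : uniq ([:: q0, q1 & q] ++ [:: r0; r1]) by rewrite (perm_uniq P) enum_uniq.
have sV : #|V| = size q + 4 by rewrite cardE -(perm_size P) size_cat /=; lia.
have sq : size [:: q0, q1 & q] = #|V| - 2 by rewrite sV /=; lia.
rewrite cat_uniq in U; case/and3P: U => Uq _ Ur.
have Kr : clique [:: r0; r1].
  by move=> x y; rewrite !inE => /orP[]/eqP-> /orP[]/eqP-> //; rewrite ?eqxx // adj_sym.
exists (@layout q0 [:: q0, q1 & q] [:: r0; r1] (#|V| - 2) 2); first exact: layout_bij.
have cross (i : 'I_(#|V| - 2)) (j : 'I_2) : (i < 2) && (j == 0 :> nat) ->
    G (nth q0 [:: q0, q1 & q] i) (nth q0 [:: r0; r1] j).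
  by case/andP=> + /eqP->; case: (nat_of_ord i) => [|[|]].
move=> [i|i] [j|j].
- by move=> H; rewrite /= clique_nth.
- exact: cross.
- by move=> H; rewrite adj_sym; exact: cross.
- by move=> H; rewrite /= clique_nth.
Qed.

Lemma embeds_G2 q0 q r0 : perm_eq ((q0 :: q) ++ [:: r0]) (enum V) ->
  (forall x, G x r0 -> x = q0) -> spanning_embeds G (G2 #|V|).
Proof.
move=> P H.
have U : uniq ((q0 :: q) ++ [:: r0]) by rewrite (perm_uniq P) enum_uniq.
have sV : #|V| = size q + 2 by rewrite cardE -(perm_size P) size_cat /=; lia.
have sq : size (q0 :: q) = #|V| - 1 by rewrite sV /=; lia.
rewrite cat_uniq in U; case/and3P: U => Uq _ _.
have bij := @layout_bij q0 (q0 :: q) [:: r0] (#|V| - 1) 1 P sq erefl.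
(* The embedding goes from [V] into the model, hence the inverse of [layout]. *)
case: (bij) => g fK gK; exists g; first exact: Bijective gK fK.
suff main u v : G (layout q0 (q0 :: q) [:: r0] u) (layout q0 (q0 :: q) [:: r0] v) -> G2 #|V| u v.
  by move=> x y e; apply: main; rewrite !gK.
have cross (i : 'I_(#|V| - 1)) (j : 'I_1) : G (nth q0 (q0 :: q) i) (nth q0 [:: r0] j) -> i == 0 :> nat.
  have li : i < size (q0 :: q) by rewrite sq.
  have l0 : 0 < size (q0 :: q) by [].
  by rewrite ord1 => /H E; rewrite -(nth_uniq q0 li l0 Uq) E.
case: u v => [i|i] [j|j] /=.
- by move=> e; apply: contraTneq e => ->; rewrite adj_irrefl.
- exact: cross.
- by rewrite adj_sym; exact: cross.
- by rewrite !ord1 /= adj_irrefl.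
Qed.

(** * Two cliques meeting at a cut vertex *)

Hypothesis noTF : forall s t, cyc G s -> nilp t || cyc G t -> perm_eq (s ++ t) (enum V) -> False.

Lemma cliqueS (q q' : seq V) : {subset q' <= q} -> clique q -> clique q'.
Proof. by move=> sub K x y /sub xq /sub; exact: K. Qed.

(** The graph is read off from the sizes of [A] and [B]: a side of one vertex is pendant at [v] and
    gives an exceptional graph, and only a side [B] of two vertices needs a further distinction. *)
Lemma cut_vertex_false v A B b : perm_eq (v :: A ++ B) (enum V) -> clique A -> clique B ->
  {in A & B, forall x y, ~~ G x y} -> {in A, forall x, G v x} -> A != [::] ->
  b \in B -> G v b -> 5 < #|V| -> ~ exceptional G -> False.
Proof.
move=> P KA KB AB vA A0 bB vb V6 nexc.
have sV : size A + size B + 1 = #|V| by rewrite cardE -(perm_size P) /= size_cat; lia.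
have U : uniq (v :: A ++ B) by rewrite (perm_uniq P) enum_uniq.
have inV x : (x == v) || (x \in A) || (x \in B).
  by rewrite -orbA -mem_cat -in_cons (perm_mem P) mem_enum.
have [UA UB] : uniq A /\ uniq B.
  by move: (U); rewrite cons_uniq cat_uniq => /and4P[].
have KvA : clique (v :: A).
  move=> x y; rewrite !inE => /predU1P[->|xA] /predU1P[->|yA]; rewrite ?eqxx //.
  - by move=> _; exact: vA.
  - by move=> _; rewrite adj_sym; exact: vA.
  - exact: KA.
have vAF x : x \in A -> (x == v) = false.
  move=> xA; apply/negbTE; apply: contraTneq U => <-; by rewrite /= mem_cat xA.
have vBF x : x \in B -> (x == v) = false.
  move=> xB; apply/negbTE; apply: contraTneq U => <-; by rewrite /= mem_cat xB orbT.
have PB := perm_to_rem bB; set B' := rem b B in PB.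
have sB : size B = (size B').+1 by rewrite (perm_size PB).
have KB' : clique (b :: B') by apply: cliqueS KB => x; rewrite (perm_mem PB).
have UB' : uniq (b :: B') by rewrite -(perm_uniq PB).
have B'b x : x \in B' -> (x == b) = false.
  by move=> xB; apply/negbTE; apply: contraTneq UB' => <-; rewrite /= xB.
have AP : perm_eq (v :: A ++ b :: B') (enum V).
  by apply: perm_trans P; rewrite perm_cons perm_cat2l perm_sym.
have nbrA a : A = [:: a] -> forall x, G x a -> x = v.
  move=> EA x e; have := inV x; rewrite EA inE -orbA => /or3P[/eqP//|/eqP xa|xB].
    by rewrite xa adj_irrefl in e.
  by have := AB a x; rewrite EA inE eqxx adj_sym e xB => /(_ isT isT).
case: (ltnP 1 (size A)) => sA; last first.
  case: A A0 sA P KA AB vA sV U inV UA KvA vAF AP nbrA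
    => [//|a [|//]] _ _ P KA AB vA sV U inV UA KvA vAF AP nbrA.
  have e_av : G v a by apply: vA; rewrite inE.
  (* Here [B] is the large clique and [v] joins it to the pendant [a]. A second neighbour of [v] in
     [B] decides between the sandwiched graphs and [G3]. *)
  apply: nexc; have [/hasP[b' b'B vb']|nb] := boolP (has (G v) B').
    left; split.
      have PB'' := perm_to_rem b'B.
      apply: (@G1_embeds b b' (rem b' B') v a) => //; rewrite 1?adj_sym //.
        by apply: perm_trans AP; perm_by_count PB''.
      by apply: cliqueS KB' => x; rewrite !inE (perm_mem PB'') inE.
    apply: (@embeds_G2 v B a) (nbrA a erefl).
    by apply: perm_trans AP; perm_by_count PB.
  right; apply: (@G3_iso b B' v a) => //.
    by apply: perm_trans AP; apply/permP=> p; rewrite /= !count_cat /=; clear; lia.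
  move=> x y xB; rewrite !inE => /orP[] /eqP->; last first.
    rewrite -[a == v]/(a == v) (vAF a) ?inE // andbF; apply/negbTE; rewrite adj_sym.
    by apply: AB; rewrite ?inE // (perm_mem PB).
  rewrite eqxx andbT; move: xB; rewrite inE => /predU1P[->|xB]; first by rewrite adj_sym vb eqxx.
  rewrite B'b //; apply/negbTE; apply: contra nb => e; apply/hasP; exists x => //.
  by rewrite adj_sym.
case EB' : B' => [|b2 B''].
  case: A A0 sA P KA AB vA sV U inV UA KvA vAF AP nbrA
    => [//|a0 [//|a1 A]] _ _ P KA AB vA sV U inV UA KvA vAF AP nbrA.
  rewrite EB' in AP.
  apply: nexc; left; split.
    apply: (@G1_embeds a0 a1 A v b) => //; rewrite 1?adj_sym ?vA ?inE ?eqxx ?orbT //.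
    by apply: perm_trans AP; apply/permP=> p; rewrite /= !count_cat /=; clear; lia.
  apply: (@embeds_G2 v [:: a0, a1 & A] b) => // x e.
  have := inV x; rewrite -orbA => /or3P[/eqP//|xA|].
    by have := AB x b xA bB; rewrite e.
  by rewrite (perm_mem PB) EB' inE => /eqP xb; rewrite xb adj_irrefl in e.
(* With three vertices or more in [B], the cliques [v :: A] and [B] give the two cycles. *)
case EB'' : B'' => [|b3 B3]; last first.
  apply: (@noTF (v :: A) B) => //; first apply: clique_cyc => //.
  - by case/andP: U => + _; rewrite /= UA mem_cat negb_or => /andP[->].
  - by apply/orP; right; apply: clique_cyc => //; rewrite sB EB' EB'' /=.
rewrite EB' EB'' in AP KB' UB' sB.
have b2B : b2 \in B by rewrite (perm_mem PB) EB' EB'' !inE eqxx orbT.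
have bb2 : G b b2.
  by apply: KB'; rewrite ?inE ?eqxx ?orbT // eq_sym B'b // EB' EB'' inE.
(* If [v] sees both vertices of [B], they form a triangle with it, and [A] has at least three
   vertices. Otherwise a single edge joins the cliques [v :: A] and [B]. *)
have [vb2|vb2] := boolP (G v b2).
  apply: (@noTF [:: v; b; b2] A).
  - by rewrite /cyc /= vb bb2 (adj_sym _ b2) vb2 !inE negb_or -andbA (eq_sym v) vBF // (eq_sym v) vBF //
      (eq_sym b) B'b // EB' EB'' inE.
  - by apply/orP; right; apply: clique_cyc => //; move: sV sB V6 => /= <- ->; clear; lia.
  - by apply: perm_trans AP; apply/permP=> p; rewrite /= !count_cat /=; clear; lia.
apply: nexc; right; apply: (@G3_iso v A b b2) => //.
move=> x y xA yB; have {}yB : y \in B by rewrite (perm_mem PB) EB' EB''.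
move: xA; rewrite inE => /predU1P[->|xA]; last by rewrite vAF //; apply/negbTE; exact: AB.
rewrite eqxx /=; move: yB; rewrite (perm_mem PB) EB' EB'' !inE => /orP[]/eqP->.
  by rewrite vb eqxx.
by rewrite (negbTE vb2) B'b // EB' EB'' inE.
Qed.

End Exceptional.

Section Invariants.

Variables (V : finType) (G : sgraph V).

Lemma independent_alpha (S : {set V}) : independent G S -> #|S| <= alpha G.
Proof. by move=> I; rewrite /alpha (bigD1 S) //= leq_maxl. Qed.

Lemma kappa_k_connected : 0 < #|V| -> k_connected G (kappa G).
Proof.
move=> V0; have [|k Gk E] := @eq_bigmax_cond _ [pred k : 'I_#|V| | k_connected G k] (@nat_of_ord _).
  apply/card_gt0P; exists (Ordinal V0); rewrite inE /k_connected V0.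
  by apply/forallP=> X; rewrite ltn0.
suff -> : kappa G = k by [].
by rewrite /kappa -E; apply: eq_bigl.
Qed.

Lemma k_connected_kappa k : k_connected G k -> k <= kappa G.
Proof.
move=> Gk; have kV : k < #|V| by case/andP: Gk.
exact: (@leq_bigmax_cond _ (fun k : 'I_#|V| => k_connected G k) (@nat_of_ord _) (Ordinal kV) Gk).
Qed.

End Invariants.

(** * Connectivity at least two, and connectivity one *)

Section Main.

Variables (V : finType) (G : sgraph V).
Hypothesis noTF : forall s t, cyc G s -> nilp t || cyc G t -> perm_eq (s ++ t) (enum V) -> False.

Lemma two_connected_false k : k_connected G k -> 1 < k -> 3 * k + 3 <= #|V| ->
  (forall S, independent G S -> #|S| <= k.+1) -> False.
Proof.
move=> Gk k2 large al.
have no_ham c : cyc G c -> exists v, v \notin c.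
  move=> cc; apply/existsP; apply: contraT; rewrite negb_exists => /forallP H.
  case: (@noTF c [::]) => //; rewrite cats0; apply: uniq_perm.
  - by case/and3P: cc.
  - exact: enum_uniq.
  - by move=> x; rewrite mem_enum; have := H x; rewrite negbK => ->.
have [c [cc Kc Xk]] := kouider Gk k2 no_ham al.
set X := [set x in c | _] in Xk.
have [_ Cc Uc] := and3P cc.
pose hs := [seq x <- enum V | x \notin c].
have hsE x : (x \in hs) = (x \notin c) by rewrite mem_filter mem_enum andbT.
have Uhs : uniq hs by rewrite filter_uniq // enum_uniq.
have P : perm_eq (c ++ hs) (enum V).
  apply: uniq_perm; last by move=> x; rewrite mem_cat hsE mem_enum orbN.
    by rewrite cat_uniq Uc Uhs andbT /=; apply/hasPn=> x; rewrite hsE.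
  exact: enum_uniq.
have Khs : {in hs &, forall x y, x != y -> G x y} by move=> x y; rewrite !hsE; exact: Kc.
(* A clique [hs] on three vertices or more carries the second cycle. *)
have [sz|sz] := ltnP 2 (size hs).
  by apply: (noTF cc _ P); apply/orP; right; exact: clique_cyc.
have [h0 h0c] := no_ham c cc; rewrite -hsE in h0c.
have Xc x : x \in X -> x \in c by rewrite inE => /andP[].
have XN x : x \in X -> exists2 f, f \in hs & G f x.
  by rewrite inE => /andP[_ /existsP[f /andP[fc e]]]; exists f; rewrite // hsE.
have hsX h v : h \in hs -> v \notin hs -> G h v -> v \in X.
  move=> hh vh e; rewrite hsE negbK in vh; rewrite inE vh; apply/existsP; exists h.
  by rewrite -hsE hh.
(* A vertex of [hs] missing two vertices of [X] has degree less than [k]. *)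
have deg h h' y z : perm_eq [:: h; h'] hs -> y \in X -> z \in X -> y != z -> G h y || G h z.
  move=> Ph yX zX yz; apply: contraT; rewrite negb_or => /andP[ny nz].
  have hh : h \in hs by rewrite -(perm_mem Ph) inE eqxx.
  have sub : [set v | G h v] \subset h' |: (X :\ y :\ z).
    apply/subsetP=> v; rewrite !in_setU !in_setD1 !in_set1 in_set => e.
    have [vh|vh] := boolP (v \in hs).
      move: vh; rewrite -(perm_mem Ph) !inE => /orP[/eqP vh|->//].
      by rewrite vh adj_irrefl in e.
    rewrite (hsX _ _ hh vh e) andbT; apply/orP; right.
    by apply/andP; split; [apply: contraNneq nz|apply: contraNneq ny] => <-.
  have := subset_leq_card sub; have := degree_ge Gk h; rewrite /degree cardsU1.
  have zXy : z \in X :\ y by rewrite in_setD1 zX eq_sym yz.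
  move: Xk; rewrite (cardsD1 y) yX (cardsD1 z (X :\ y)) zXy /=.
  by case: (h' \notin _) => /=; nat_lia.
apply: (@spanning_mod_hs_false V G X hs h0 _ hsX h0c noTF _ _ _ _ sz _ c).
- move=> y z yX zX yz.
  case Ehs: hs sz h0c Khs deg XN => [//|h1 [|h2 [|//]]] _ _ Khs deg XN.
    have h1E x : x \in X -> G h1 x by move=> /XN[f]; rewrite inE => /eqP->.
    by exists [:: h1], h1, h1; split; rewrite ?walk1 ?h1E // adj_sym h1E.
  have h12 : G h1 h2.
    apply: Khs; rewrite ?inE ?eqxx ?orbT //.
    by move: Uhs; rewrite Ehs /= inE => /andP[].
  have X12 x : x \in X -> G h1 x || G h2 x.
    by move=> /XN[f]; rewrite !inE => /orP[]/eqP-> ->; rewrite ?orbT.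
  have P1 : perm_eq [:: h2; h1] [:: h1; h2] by rewrite (perm_catC [:: h2] [:: h1]).
  (* Each of [y], [z] has a neighbour among [h1], [h2] by [X12], and conversely by [deg]; so one of
     the two matchings between the pairs exists. *)
  have [/andP[e1 e2]|n1] := boolP (G h1 y && G h2 z).
    by exists [:: h1; h2], h1, h2; rewrite /= !eqxx h12 adj_sym.
  exists [:: h2; h1], h2, h1; rewrite /= !eqxx adj_sym h12 (adj_sym _ y); split=> //.
    have := X12 _ yX; have := X12 _ zX; have := deg h2 h1 y z P1 yX zX yz.
    by move: n1; case: (G h1 y); case: (G h2 y); case: (G h2 z); case: (G h1 z).
  have := X12 _ yX; have := X12 _ zX; have := deg h1 h2 y z (perm_refl _) yX zX yz.
  by move: n1; case: (G h1 y); case: (G h2 y); case: (G h2 z); case: (G h1 z).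
- by rewrite Xk.
- by move: large k2; clear; lia.
- by rewrite Xk.
- by rewrite Xk.
- by move=> h _; rewrite Xk; exact: degree_ge.
- by split.
Qed.

(** Removing a cut vertex [v] leaves a component [A] and a rest [B]. Having no three independent
    vertices makes both cliques and makes [v] complete to one of them. *)
Lemma one_connected_false : k_connected G 1 -> ~~ k_connected G 2 -> 5 < #|V| ->
  (forall S, independent G S -> #|S| <= 2) -> ~ exceptional G -> False.
Proof.
move=> G1c nG2 V6 al nexc.
have V2 : 2 < #|V| by lia.
move: nG2; rewrite /k_connected V2 negb_forall => /existsP[X].
rewrite negb_imply => /andP[X1].
have [X0|] := eqVneq X set0.
  by case/andP: G1c => _ /forallP/(_ X); rewrite X0 cards0 /= => ->.
rewrite -card_gt0 => X0; have /cards1P[v ->] : #|X| == 1 by rewrite eqn_leq -ltnS X1 X0.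
rewrite negb_and negbK => /orP[/eqP E|].
  have := cardsC [set v]; rewrite cards1 E cards0; move: V2; clear; lia.
case/forall_inPn=> x; rewrite !inE => xv /forall_inPn[y]; rewrite !inE => yv nco.
set e := induced G _ in nco.
pose A := [seq a <- enum V | (a != v) && connect e x a].
pose B := [seq a <- enum V | (a != v) && ~~ connect e x a].
have AE a : (a \in A) = (a != v) && connect e x a by rewrite mem_filter mem_enum andbT.
have BE a : (a \in B) = (a != v) && ~~ connect e x a by rewrite mem_filter mem_enum andbT.
have UA : uniq A by rewrite filter_uniq // enum_uniq.
have UB : uniq B by rewrite filter_uniq // enum_uniq.
have xA : x \in A by rewrite AE xv connect0.
have yB : y \in B by rewrite BE yv.
have AB : {in A & B, forall a b, ~~ G a b}.
  move=> a b; rewrite AE BE => /andP[av ca] /andP[bv nb]; apply: contra nb => eab.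
  by apply: connect_trans ca (connect1 _); rewrite /e /induced /= !inE av bv.
have nABeq a b : a \in A -> b \in B -> a != b.
  by rewrite AE BE => /andP[_ ca] /andP[_ cb]; apply: contraNneq cb => <-.
have indep3 a b d : ~~ G a b -> ~~ G a d -> ~~ G b d -> a != b -> a != d -> b != d -> False.
  move=> n1 n2 n3 d1 d2 d3.
  have I1 : independent G [set d] by apply/independentP=> p q /set1P-> /set1P->; rewrite adj_irrefl.
  have I2 : independent G (b |: [set d]) by apply: independentU1 => // p /set1P->.
  have I3 : independent G (a |: (b |: [set d])).
    by apply: independentU1 => // p /setU1P[->//|/set1P->].
  by have := al _ I3; rewrite !cardsU1 cards1 !inE negb_or d1 d2 d3.
have KA : clique G A.
  move=> a b aA bA ab; apply: contraT => n; case: (indep3 a b y) => //;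
    [exact: AB|exact: AB|exact: nABeq|exact: nABeq].
have KB : clique G B.
  move=> a b aB bB ab; apply: contraT => n; case: (indep3 x a b) => //;
    [exact: AB|exact: AB|exact: nABeq|exact: nABeq].
have P : perm_eq (v :: A ++ B) (enum V).
  apply: uniq_perm; last first.
  - by move=> a; rewrite inE mem_cat AE BE mem_enum; case: eqVneq => //=; case: connect.
  - exact: enum_uniq.
  - rewrite /= mem_cat AE BE eqxx cat_uniq UA UB andbT /=; apply/hasPn=> b bB.
    by apply/negP=> bA; have := nABeq _ _ bA bB; rewrite eqxx.
(* Connectivity, as the case of the empty separator, gives [v] a neighbour on either side. *)
have nbr (F F' : seq V) f : f \in F -> v \notin F -> {in F & F', forall a b, ~~ G a b} ->
    (forall a, [|| a == v, a \in F | a \in F']) -> exists2 b, b \in F & G v b.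
  move=> fF vF FF' cov; apply/hasP; apply: contraT => /hasPn n.
  suff : 1 <= #|(set0 : {set V})| by rewrite cards0.
  apply: (@boundary_card _ _ _ G1c [set a in F] set0 f v); rewrite ?inE //.
  move=> a b; rewrite !inE => aF _ eab _; case/or3P: (cov b) => // [/eqP bv|bF'].
    by have := n _ aF; rewrite -bv adj_sym eab.
  by have := FF' _ _ aF bF'; rewrite eab.
have vAn : v \notin A by rewrite AE eqxx.
have vBn : v \notin B by rewrite BE eqxx.
have cov a : [|| a == v, a \in A | a \in B].
  by rewrite -mem_cat -in_cons (perm_mem P) mem_enum.
have BA : {in B & A, forall p q, ~~ G p q} by move=> p q pB qA; rewrite adj_sym AB.
have covC p : [|| p == v, p \in B | p \in A] by rewrite [(p \in B) || _]orbC.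
have [b bB vb] := nbr B A y yB vBn BA covC.
have [a aA va] := nbr A B x xA vAn AB cov.
(* If [v] misses [a'] in [A], it misses no [b'] in [B], as [v], [a'], [b'] would be independent. *)
have [/allP vA|/allPn[a' a'A na']] := boolP (all (G v) A).
  by apply: (cut_vertex_false noTF P KA KB AB vA _ bB vb V6 nexc); case: (A) xA.
have vB : {in B, forall b', G v b'}.
  move=> b' b'B; apply: contraT => nb'; case: (indep3 v a' b') => //.
  - exact: AB.
  - by apply: contraNneq vAn => ->.
  - by apply: contraNneq vBn => ->.
  - exact: nABeq.
apply: (cut_vertex_false noTF _ KB KA BA vB _ aA va V6 nexc).
- by rewrite -(permPr P) perm_cons perm_catC.
- by case: (B) yB.
Qed.

End Main.

Unset Implicit Arguments.

Theorem theorem1p5 (V : finType) (G : sgraph V)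
    (Gconn : connected_graph G)
    (large : 3 * kappa G + 3 <= #|V|)
    (alpha_le : alpha G <= kappa G + 1)
    (not_exceptional : ~ exceptional G) :
  exists2 F : sgraph V, two_factor G F & n_components F <= 2.
Proof.
apply: NNPP => noF.
have noTF s t : cyc G s -> nilp t || cyc G t -> perm_eq (s ++ t) (enum V) -> False.
  by move=> cs ct P; apply: noF; exact: two_cycles_two_factor cs ct P.
have V2 : 2 < #|V| by lia.
have Gk := kappa_k_connected G (ltnW (ltnW V2)).
(* Only the empty set has fewer than one element, so this is [Gconn]. *)
have G1c : k_connected G 1.
  rewrite /k_connected (ltnW V2); apply/forallP=> X; apply/implyP.
  by rewrite ltnS leqn0 cards_eq0 => /eqP->; rewrite setC0.
have k1 := k_connected_kappa G1c.
have al S : independent G S -> #|S| <= (kappa G).+1.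
  by move=> /independent_alpha le; rewrite -addn1; exact: leq_trans le alpha_le.
have [k2|k2] := ltnP 1 (kappa G).
  exact: (two_connected_false noTF Gk k2 large al).
have kE : kappa G = 1 by apply/eqP; rewrite eqn_leq k2.
apply: (one_connected_false noTF G1c _ _ _ not_exceptional).
- by apply/negP=> /k_connected_kappa; rewrite kE.
- by move: large; rewrite kE.
- by move=> S /al; rewrite kE.
Qed.
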